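(* Let $\xi_1,\dots,\xi_n$ be independent real random variables such that $\mathbb E\xi_i=0$, $\operatorname{Var}(\xi_i)=1$, and, for some $M>0$, $$\inf_{1\le i\le n}\mathbb E\big[\xi_i^2\mathbf 1_{\{|\xi_i|\le M\}}\big]\ge\frac12.$$ Let $w_1,\dots,w_n\in\mathbb R^m$ be fixed vectors. If $$\sum_{i=1}^nw_iw_i^\top\succeq I_m,\qquad \max_{1\le i\le n}\|w_i\|_2\le\rho$$ for some $\rho>0$, then there is a constant $C=C(M)<\infty$ (depending only on $M$) such that for every $\eta\ge C\rho$, $$\sup_{z\in\mathbb R^m}\mathbb P\left(\Big\|\sum_{i=1}^nw_i\xi_i-z\Big\|_2\le\eta\sqrt m\right)\le(C\eta)^m.$$ *)

(* Defs.v *)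
From mathcomp Require Import all_boot all_order all_algebra.
From mathcomp Require Import all_classical all_reals all_analysis.

Set Implicit Arguments.
Unset Strict Implicit.
Unset Printing Implicit Defensive.

Import Order.TTheory GRing.Theory Num.Theory.
Import numFieldNormedType.Exports.

Local Open Scope classical_set_scope.
Local Open Scope ring_scope.

(* The library norm `|v| on matrices is the sup norm, hence this definition. *)
Definition l2norm (R : realType) (m : nat) (v : 'cV[R]_m) : R :=
  Num.sqrt (\sum_(j < m) v j 0 ^+ 2).

Definition psdmx (R : realType) (m : nat) (A : 'M[R]_m) : Prop :=
  A^T = A /\ forall x : 'cV[R]_m, 0 <= (x^T *m A *m x) 0 0.

Definition loewner_ge (R : realType) (m : nat) (A B : 'M[R]_m) : Prop :=
  psdmx (A - B).

(* Mutual (not merely pairwise) independence: the product rule is required for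
   every subfamily J. *)
Definition mutually_independent (d : measure_display) (T : measurableType d)
    (R : realType) (P : probability T R) (I : finType)
    (X : I -> {RV P >-> R}) : Prop :=
  forall (J : {set I}) (B : I -> set R), (forall i, measurable (B i)) ->
    P (\bigcap_(i in [set` J]) (X i @^-1` B i)) =
    (\prod_(i in J) P (X i @^-1` B i))%E.

(* Main.v *)
Require Import Defs.
From mathcomp Require Import all_boot all_order all_fingroup all_algebra.
From mathcomp Require Import complex.
From mathcomp Require Import all_classical all_reals all_analysis.
From mathcomp Require Import measurable_realfun ring lra.

Set Implicit Arguments.
Unset Strict Implicit.
Unset Printing Implicit Defensive.

Import Order.TTheory GRing.Theory Num.Theory.
Import numFieldNormedType.Exports.

Local Open Scope classical_set_scope.
Local Open Scope ring_scope.

(** The estimate is Fourier-analytic.  Replacing the w_i by their images under a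
    suitable linear contraction, which only shrinks distances, one may assume
    that sum_i w_i w_i^T = I.  The indicator of a ball of radius of order
    eta sqrt m is at most e^(2m) times a Gaussian-like window of width eta, and
    this window is an average of the characters cos <theta, x> over roughly
    Gaussian frequencies theta of size 1/eta.  By independence the probability is
    thus at most e^(2m) times the average over theta of the product of the
    |phi_i(<w_i, theta>)|, where phi_i is the characteristic function of xi_i.
    Two facts bound this average by (C eta)^m.

    In one dimension, the moment hypotheses say that xi_i is spread out at a
    bounded scale, so 1 - |phi_i(u)|^2 >= u^2/16 for |u| <= delta = 1/(M + 13)
    ([quantized_gap]).  The function 1 - |phi_i|^2 is subadditive up to a factor
    2, so on each interval of length delta, |phi_i| is dominated by one Gaussian
    bump of bounded width ([peak_itv]).  Nothing makes phi_i decay at infinity,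
    as lattice variables show; this is where eta >= C rho enters.  Measured in
    units of |w_i| these intervals have length at least delta/rho, so a Gaussian
    weight of width 1/eta only sees boundedly many of them
    ([exp_energy_le_gauss_mixture]).

    In dimension m, the one-dimensional bounds are combined by a form of Ball's
    geometric Brascamp-Lieb inequality with the non-sharp constant e^(m/2)
    ([weak_brascamp_lieb]).  By Cauchy-Binet the numbers
    p_f = det(w_(f 1), ..., w_(f m))^2 / m! form a probability on the families f
    of m indices, under which the index i is picked |w_i|^2 times on average.
    A product over i with exponents |w_i|^2 is therefore a geometric mean over f
    of products over the m members of f, and for a linearly independent family
    such a product becomes a product of Gaussians after a linear change of
    variables.  The Jacobians cost at most (m^m / m!)^(1/2) <= e^(m/2) by
    Jensen's inequality.

    All of this is done with finite sums.  A power of a cosine is exactly a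
    binomial average of characters, so theta runs over a fine finite grid, on
    which Gaussian sums are bounded by elimination along a Cholesky factor
    ([gauss_sum_det]).  The xi_i are first rounded to finitely many values
    ([small_ball_approx]); the rounded variables have a product law directly by
    the definition of independence. *)

(** * Cauchy-Binet weights and Cholesky factorisation *)

(** Both sides are the determinant of the block matrix with rows (1, -w) and
    (w^T, 1), eliminated in its two possible orders. *)
Lemma det_1_plus_mulmx_tr (R : comNzRingType) (m : nat) (w : 'cV[R]_m) :
  \det (1%:M + w *m w^T) = 1 + (w^T *m w) 0 0.
Proof.
have lE : block_mx 1%:M 0 w^T 1%:M *m block_mx 1%:M (- w) 0 (1%:M + w^T *m w)
          = block_mx 1%:M (- w) w^T 1%:M :> 'M[R]_(m + 1).
  rewrite mulmx_block !(mulmx1, mul1mx, mulmx0, mul0mx, addr0).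
  by congr block_mx; rewrite mulmxN addrC addrK.
have uE : block_mx (1%:M + w *m w^T) (- w) 0 1%:M *m block_mx 1%:M 0 w^T 1%:M
          = block_mx 1%:M (- w) w^T 1%:M :> 'M[R]_(m + 1).
  rewrite mulmx_block !(mulmx1, mul1mx, mulmx0, mul0mx, add0r).
  by congr block_mx; rewrite mulNmx addrK.
have := congr1 determinant (etrans lE (esym uE)).
rewrite !det_mulmx !det_lblock !det_ublock !det1 !mul1r !mulr1 => <-.
by rewrite (mx11_scalar (1%:M + _)) det_scalar1 !mxE eqxx.
Qed.

Lemma sum_perm_const (R : comNzRingType) m (x : R) :
  \sum_(s : 'S_m) x = m`!%:R * x.
Proof.
have cardE : #|{: 'S_m}| = m`! by rewrite -card_Sn; apply: eq_card => s; rewrite !inE.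
by rewrite big_const iter_addr_0 cardE mulr_natl.
Qed.

(** Cauchy-Binet summed over all index maps f instead of over subsets, which
    accounts for the factor m!.  The weights d are there to read off marginals
    later: a perturbation of one d k detects how often f picks k. *)
Lemma cauchy_binet_weighted (R : comNzRingType) (m n : nat)
    (W : 'M[R]_(m, n)) (d : 'I_n -> R) :
  \sum_(f : {ffun 'I_m -> 'I_n})
    (\prod_j d (f j)) * \det (colsub f W) ^+ 2 =
  m`!%:R * \det (W *m diag_mx (\row_k d k) *m W^T).
Proof.
pose S := \sum_(f : {ffun 'I_m -> 'I_n})
  (\prod_j d (f j)) * (\prod_i W i (f i) * \det (colsub f W)).
transitivity (\sum_(s : 'S_m) S); last first.
  rewrite sum_perm_const; congr (_ * _).
  transitivity (\sum_(s : 'S_m) \sum_(f : {ffun 'I_m -> 'I_n})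
     (-1) ^+ s * \prod_i (d (f i) * W i (f i) * W (s i) (f i))); last first.
    apply: eq_bigr => s _; rewrite -mulr_sumr; congr (_ * _).
    rewrite -(bigA_distr_bigA (fun i k => d k * W i k * W (s i) k)).
    apply: eq_bigr => i _; rewrite mxE; apply: eq_bigr => k _.
    rewrite !mxE (bigD1 k) //= !mxE eqxx big1 ?addr0 ?mulr1n; first by ring.
    by move=> l /negPf lk; rewrite !mxE lk mulr0n mulr0.
  rewrite exchange_big; apply: eq_bigr => f _ /=.
  rewrite -det_tr /determinant 2!mulr_sumr; apply: eq_bigr => s _.
  rewrite !big_split /=.
  have -> : \prod_i (colsub f W)^T i (s i) = \prod_i W (s i) (f i).
    by apply: eq_bigr => i _; rewrite !mxE.
  move: ((-1) ^+ s) (\prod_j d (f j)) (\prod_i W i (f i)) (\prod_i _).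
  by move=> e a b c; ring.
under eq_bigr => f _ do rewrite expr2 {1}/determinant mulr_suml mulr_sumr.
rewrite exchange_big; apply: eq_bigr => s _ /=.
have sK : {on predT, bijective
    (fun f : {ffun 'I_m -> 'I_n} => [ffun i => f (s^-1 i)%g])}.
  exists (fun f => [ffun i => f (s i)]) => f _; apply/ffunP => i;
  by rewrite !ffunE ?permK ?permKV.
rewrite (reindex _ sK); apply: eq_bigr => f _ /=.
have -> : colsub [ffun i => f (s^-1 i)%g] W = col_perm s^-1 (colsub f W).
  by apply/matrixP => i j; rewrite !mxE !ffunE.
have -> : \prod_j d ([ffun i => f (s^-1 i)%g] j) = \prod_j d (f j).
  rewrite [RHS](reindex_inj (@perm_inj _ s^-1)).
  by apply: eq_bigr => j _; rewrite ffunE.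
have -> : \prod_i (col_perm s^-1 (colsub f W)) i (s i) = \prod_i W i (f i).
  by apply: eq_bigr => j _; rewrite !mxE permK.
rewrite col_permE det_mulmx det_perm invgK.
move: (\prod_j d (f j)) (\prod_i W i (f i)) (\det _) => a b c.
transitivity (a * (b * c) * ((-1) ^+ s * (-1) ^+ s)).
  by move: ((-1) ^+ s) => e; ring.
by rewrite -signr_addb addbb mulr1.
Qed.

Lemma det_colsub_inj (R : comNzRingType) (m n : nat) (W : 'M[R]_(m, n))
    (f : {ffun 'I_m -> 'I_n}) : \det (colsub f W) != 0 -> injective f.
Proof.
move=> det0 i j fij; apply/eqP; apply: contraNT det0 => ij.
rewrite -det_tr; apply/eqP/(determinant_alternate ij) => k.
by rewrite !mxE fij.
Qed.

(** The determinantal probability on m-tuples of columns of W. *)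
Definition basis_weight (R : fieldType) m n (W : 'M[R]_(m, n))
  (f : {ffun 'I_m -> 'I_n}) : R := \det (colsub f W) ^+ 2 / m`!%:R.

Section BasisWeight.
Variables (R : realFieldType) (m n : nat) (W : 'M[R]_(m, n)).
Hypothesis W1 : W *m W^T = 1%:M.

Lemma basis_weight_ge0 f : 0 <= basis_weight W f.
Proof. by rewrite divr_ge0 ?sqr_ge0. Qed.

Let fact_neq0 : m`!%:R != 0 :> R.
Proof. by rewrite pnatr_eq0 -lt0n fact_gt0. Qed.

Lemma basis_weight_sum (d : 'I_n -> R) :
  \sum_f basis_weight W f * \prod_j d (f j) =
  \det (W *m diag_mx (\row_k d k) *m W^T).
Proof.
apply: (mulfI fact_neq0); rewrite -cauchy_binet_weighted mulr_sumr.
apply: eq_bigr => f _; rewrite /basis_weight; field; exact: fact_neq0.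
Qed.

Lemma basis_weight_sum1 : \sum_f basis_weight W f = 1.
Proof.
have := basis_weight_sum (fun=> 1).
have -> : diag_mx (\row_(_ < n) (1 : R)) = 1%:M.
  by apply/matrixP => i j; rewrite !mxE.
rewrite mulmx1 W1 det1 => <-.
by apply: eq_bigr => f _; rewrite big1 ?mulr1.
Qed.

(** Doubling the weight of column i turns W W^T = 1 into 1 + w w^T, whose
    determinant is 1 + |w|^2; on the other side it multiplies the weight of f by
    2 exactly when f picks i, because a family of nonzero weight picks i at most
    once. *)
Lemma basis_weight_marginal (i : 'I_n) :
  \sum_f basis_weight W f * \sum_j (f j == i)%:R = \sum_j W j i ^+ 2.
Proof.
have := basis_weight_sum (fun k => 1 + (k == i)%:R).
have -> : W *m diag_mx (\row_k (1 + (k == i)%:R)) *m W^T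
          = 1%:M + col i W *m (col i W)^T.
  rewrite -W1; apply/matrixP => a b; rewrite !mxE big_ord1 !mxE.
  have -> : W a i * W b i = \sum_k (k == i)%:R * (W a k * W b k).
    rewrite (bigD1 i) //= eqxx mul1r big1 ?addr0 // => k /negPf ->.
    by rewrite mul0r.
  rewrite -big_split; apply: eq_bigr => k _ /=.
  rewrite !mxE (bigD1 k) //= !mxE eqxx big1 ?addr0 ?mulr1n; first by ring.
  by move=> l /negPf lk; rewrite !mxE lk mulr0n mulr0.
rewrite det_1_plus_mulmx_tr mxE.
under [X in _ = _ + X -> _]eq_bigr do rewrite !mxE -expr2.
move=> /(canLR (addKr _)) <-.
rewrite [in RHS]addrC -[X in _ = _ - X]basis_weight_sum1 -sumrB.
apply: eq_bigr => f _.
have [d0|/det_colsub_inj finj] := eqVneq (\det (colsub f W)) 0.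
  by rewrite /basis_weight d0 expr0n /= !mul0r subr0.
rewrite -[X in _ = _ - X]mulr1 -mulrBr; congr (_ * _).
have [j fj|nof] := pickP (fun j => f j == i); last first.
  by rewrite !big1 ?subrr // => j _; rewrite nof ?addr0.
have other k : k != j -> (f k == i) = false.
  by move=> kj; rewrite -(eqP fj); apply: contraNF kj => /eqP /finj ->.
rewrite (bigD1 j) // [in RHS](bigD1 j) //= fj !big1 => [|k /other ->|k /other ->] //.
  by ring.
by rewrite addr0.
Qed.
End BasisWeight.

(** Proved by taking the Schur complement of the upper left entry. *)
Lemma cholesky (R : rcfType) (m : nat) (A : 'M[R]_m) :
  A^T = A -> (forall x : 'cV[R]_m, x != 0 -> 0 < (x^T *m A *m x) 0 0) ->
  exists L : 'M[R]_m,
    [/\ is_trig_mx L, forall i, 0 < L i i & L *m L^T = A].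
Proof.
elim: m A => [|m IH] A sA pA.
  exists 0; split; [by apply/is_trig_mxP; case | by case | by apply/matrixP; case].
rewrite -[m.+1]/(1 + m)%N in A sA pA *.
pose a := A 0 0; pose r : 'rV_m := ursubmx A; pose D : 'M[R]_m := drsubmx A.
have AE : A = block_mx a%:M r r^T D.
  rewrite -[LHS]submxK; congr block_mx.
  - by rewrite [LHS]mx11_scalar !mxE; congr ((A _ _)%:M); apply: val_inj.
  - by rewrite /r trmx_ursub sA.
have a0 : 0 < a.
  have := pA (col_mx 1%:M 0).
  rewrite AE tr_col_mx trmx0 tr_scalar_mx mul_row_block mul_row_col.
  rewrite !(mul0mx, mulmx0, mul1mx, mulmx1, addr0) mxE eqxx mulr1n; apply.
  by rewrite col_mx_eq0 -[1%:M]/(1 : 'M[R]_1) oner_eq0.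
have DT : D^T = D by rewrite /D -[in LHS]sA trmx_drsub trmxK.
clearbody r D.
have [|y y0|L [tL dL LE]] := IH (D - a^-1 *: (r^T *m r)).
- have Dij i j : D j i = D i j by rewrite -[in LHS]DT mxE.
  apply/matrixP => i j; rewrite !mxE Dij; congr (_ - _ * _).
  by apply: eq_bigr => k _; rewrite !mxE mulrC.
- pose t : 'cV[R]_1 := - a^-1 *: (r *m y).
  have := pA (col_mx t y).
  have -> : (col_mx t y)^T *m A *m col_mx t y =
            y^T *m (D - a^-1 *: (r^T *m r)) *m y.
    rewrite AE tr_col_mx mul_row_block mul_row_col /t.
    have -> : (- a^-1 *: (r *m y))^T = - a^-1 *: (y^T *m r^T).
      by rewrite -trmx_mul; apply/matrixP => i j; rewrite !mxE.
    rewrite mul_mx_scalar.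
    rewrite scalerA mulrN mulfV ?gt_eqF // scaleN1r addNr mul0mx add0r.
    rewrite mulmxDl mulmxBr mulmxBl addrC -!scalemxAl -!scalemxAr -!scalemxAl.
    by rewrite !mulmxA scaleNr.
  apply; apply: contraNneq y0 => /eqP.
  by rewrite col_mx_eq0 => /andP[_ ->].
- exists (block_mx (Num.sqrt a)%:M 0 ((Num.sqrt a)^-1 *: r^T) L).
  have sa0 : Num.sqrt a != 0 by rewrite gt_eqF ?sqrtr_gt0.
  split.
  + by rewrite is_trig_block_mx // eqxx tL scalar_mx_is_trig.
  + move=> i; case: (split_ordP i) => j ->.
      by rewrite block_mxEul mxE eqxx mulr1n sqrtr_gt0.
    by rewrite block_mxEdr.
  + rewrite tr_block_mx mulmx_block AE !trmx0 !mulmx0 !mul0mx !addr0 LE.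
    rewrite tr_scalar_mx linearZ /= trmxK -scalar_mxM -expr2 sqr_sqrtr ?ltW //.
    congr block_mx.
    * by rewrite mul_scalar_mx scalerA mulfV // scale1r.
    * by rewrite mul_mx_scalar scalerA mulfV // scale1r.
    * rewrite -scalemxAl -scalemxAr scalerA -invfM -expr2 sqr_sqrtr ?ltW //.
      by rewrite addrC subrK.
Qed.

(** * Elementary bounds and Gaussian sums over fine grids *)

Section Trig.
Variable R : realType.
Implicit Types x y : R.

Lemma sin_MVT x : 0 <= x -> exists2 c, 0 <= c <= x & sin x = cos c * x.
Proof.
move=> x0.
have [|c cx] := @MVT_segment R (@sin R) (@cos R) 0 x x0 (fun x _ => is_derive_sin x).
  by apply: continuous_subspaceT => y; exact: continuous_sin.
by rewrite sin0 !subr0 => ->; exists c.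
Qed.

Lemma sin_sqr_norm x : sin x ^+ 2 = sin `|x| ^+ 2.
Proof. by case: (ger0P x) => _ //; rewrite sinN sqrrN. Qed.

Lemma sin_sqr_le x : sin x ^+ 2 <= x ^+ 2.
Proof.
rewrite sin_sqr_norm -(real_normK (num_real x)).
have [c _ ->] := sin_MVT (normr_ge0 x).
by rewrite exprMn ler_piMl ?sqr_ge0 // -(real_normK (num_real (cos c))) expr_le1 ?cos_max.
Qed.

Lemma cos_half y : cos y = 1 - 2 * sin (y / 2) ^+ 2.
Proof.
have {1}-> : y = (y / 2) *+ 2 by rewrite -mulr_natr; field.
by rewrite cos_mulr2n cos2sin2; ring.
Qed.

Lemma cos_ge_quadratic y : 1 - y ^+ 2 / 2 <= cos y.
Proof. by rewrite cos_half; have := sin_sqr_le (y / 2); lra. Qed.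

(** From sin x >= x/2 on [0, 1], by the mean value theorem. *)
Lemma cos_le_quadratic y : `|y| <= 2 -> y ^+ 2 / 8 <= 1 - cos y.
Proof.
move=> y2; rewrite cos_half sin_sqr_norm.
have [c /andP[c0 cy] ->] := sin_MVT (normr_ge0 (y / 2)).
have cl : 2^-1 <= cos c.
  have := cos_ge_quadratic c; rewrite normrM normfV (@ger0_norm _ 2) // in cy.
  have c1 : c <= 1 by lra.
  have : c ^+ 2 <= 1 by rewrite expr_le1.
  by lra.
rewrite exprMn (real_normK (num_real _)).
have : 4^-1 <= cos c ^+ 2 by nra.
by have := sqr_ge0 y; nra.
Qed.

Lemma expRN_le_half x : 0 <= x <= 1 -> expR (- x) <= 1 - x / 2.
Proof.
move=> /andP[x0 x1]; rewrite expRN.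
have := expR_ge1Dx x; have := expR_gt0 x => e0 e1.
rewrite -[leLHS]div1r ler_pdivrMr //; nra.
Qed.

End Trig.

Section Grid.
Variable R : realType.

Definition sqnorm m (x : 'cV[R]_m) : R := \sum_j x j 0 ^+ 2.
Definition dotp m (x y : 'cV[R]_m) : R := \sum_j x j 0 * y j 0.

(** The points of h Z at distance at most h K from 0. *)
Definition line_grid (h : R) (K : nat) : seq R :=
  [seq h * (l%:R - K%:R) | l <- iota 0 K.*2.+1].

Fixpoint grid (g : seq R) m : seq 'cV[R]_m :=
  if m is k.+1 then
    [seq (col_mx x%:M v : 'cV_(1 + k)) | x <- g, v <- grid g k]
  else [:: 0].

Lemma big_gridS (g : seq R) m (F : 'cV[R]_(1 + m) -> R) :
  \sum_(v <- grid g (1 + m)) F v =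
  \sum_(x <- g) \sum_(v <- grid g m) F (col_mx x%:M v).
Proof. exact: big_allpairs_dep. Qed.

Lemma big_line_grid h K (F : R -> R) :
  \sum_(x <- line_grid h K) F x = \sum_(l < K.*2.+1) F (h * (l%:R - K%:R)).
Proof.
rewrite big_map -(big_mkord xpredT (fun l : nat => F (h * (l%:R - K%:R)))).
by rewrite /index_iota subn0.
Qed.

Lemma mem_grid g m (v : 'cV[R]_m) : v \in grid g m -> forall j, v j 0 \in g.
Proof.
elim: m v => [|m IH] v /=; first by move=> _ [].
move=> /allpairsP[[x u] /= [xg /IH ug ->]] j.
rewrite -[m.+1]/(1 + m)%N in j *.
by case: (split_ordP j) => k ->; rewrite ?col_mxEu ?col_mxEd // ord1 mxE eqxx.
Qed.

Lemma big_grid0 (g : seq R) (F : 'cV[R]_0 -> R) : \sum_(v <- grid g 0) F v = F 0.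
Proof. exact: big_seq1. Qed.

Arguments grid : simpl never.
Arguments line_grid : simpl never.

Lemma sqnorm_col m (x : R) (v : 'cV[R]_m) : sqnorm (col_mx x%:M v) = x ^+ 2 + sqnorm v.
Proof.
rewrite /sqnorm big_split_ord big_ord1 /= col_mxEu mxE eqxx mulr1n.
by congr (_ + _); apply: eq_bigr => j _; rewrite col_mxEd.
Qed.

Lemma dotp_col m (x : R) (v : 'cV[R]_m) (y : 'cV[R]_(1 + m)) :
  dotp (col_mx x%:M v) y = x * y 0 0 + dotp v (dsubmx y).
Proof.
rewrite /dotp big_split_ord big_ord1 /= col_mxEu mxE eqxx mulr1n.
congr (_ * y _ _ + _); first exact: val_inj.
by apply: eq_bigr => j _; rewrite col_mxEd mxE.
Qed.

Lemma sqnormE m (x : 'cV[R]_m) : sqnorm x = (x^T *m x) 0 0.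
Proof. by rewrite mxE; apply: eq_bigr => j _; rewrite mxE expr2. Qed.

Lemma sqnorm_ge0 m (x : 'cV[R]_m) : 0 <= sqnorm x.
Proof. by apply: sumr_ge0 => j _; rewrite sqr_ge0. Qed.

Lemma sqnorm_eq0 m (x : 'cV[R]_m) : sqnorm x = 0 -> x = 0.
Proof.
move=> /eqP; rewrite psumr_eq0; last by move=> j _; rewrite sqr_ge0.
move=> /allP xj; apply/colP => j; rewrite mxE; apply/eqP.
by have := xj j (mem_index_enum j); rewrite /= sqrf_eq0.
Qed.

Let G (y : R) := y / (1 + `|y|).

Let G_bound y : -1 <= G y <= 1.
Proof.
have y0 := normr_ge0 y; rewrite /G; have p : 0 < 1 + `|y| by lra.
rewrite ler_pdivlMr // ler_pdivrMr //; have := ler_norm y.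
by have := ler_norm (- y); rewrite normrN; lra.
Qed.

Let gauss_le_G y t : 0 < t <= 1 -> t * expR (- y ^+ 2) <= 4 * (G (y + t) - G y).
Proof.
move=> /andP[t0 t1]; set a := `|y|; have a0 : 0 <= a := normr_ge0 y.
have step : t / ((1 + a) * (2 + a)) <= G (y + t) - G y.
  set b := `|y + t|; have b0 : 0 <= b := normr_ge0 _.
  have ba : b <= 1 + a.
    by apply: le_trans (ler_normD _ _) _; rewrite -/a (gtr0_norm t0); lra.
  have -> : G (y + t) - G y = ((y + t) * (1 + a) - y * (1 + b)) / ((1 + a) * (1 + b)).
    by rewrite /G -/a -/b; field; apply/andP; split; apply: lt0r_neq0; lra.
  apply: (@le_trans _ _ (t / ((1 + a) * (1 + b)))).
    by rewrite ler_pM2l // lef_pV2 ?posrE; nra.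
  rewrite ler_pM2r ?invr_gt0; last by nra.
  rewrite /a /b; case: (ger0P y) => ?; case: (ger0P (y + t)) => ?; nra.
apply: (@le_trans _ _ (4 * (t / ((1 + a) * (2 + a))))); last by rewrite ler_pM2l.
rewrite mulrCA ler_pM2l // -(real_normK (num_real y)) -/a expRN.
have := expR_ge1Dx (a ^+ 2) => e1.
have e2 : 0 < expR (a ^+ 2) := expR_gt0 _.
have d0 : 0 < (1 + a) * (2 + a) by nra.
rewrite -[leLHS]div1r ler_pdivrMr // mulrAC ler_pdivlMr // mul1r.
by apply: (@le_trans _ _ (4 * (1 + a ^+ 2))); [nra|lra].
Qed.

(** The terms are dominated by increments of y / (1 + |y|), an increasing
    function with values in [-1, 1], so that the sum telescopes.  The step
    condition h * a <= 1 says that the grid resolves the Gaussian. *)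
Lemma gauss_sum1 h K a b : 0 < h -> 0 < a -> h * a <= 1 ->
  h * \sum_(x <- line_grid h K) expR (- (a * x + b) ^+ 2) <= 8 / a.
Proof.
move=> h0 a0 ha; rewrite big_line_grid ler_pdivlMr // mulrAC mulr_sumr.
pose y (l : nat) := a * (h * (l%:R - K%:R)) + b.
have -> : 8 = 4 * 2 :> R by rewrite -natrM.
apply: (@le_trans _ _ (\sum_(0 <= l < K.*2.+1) 4 * (G (y l.+1) - G (y l)))).
  rewrite big_mkord ler_sum // => l _.
  have -> : y l.+1 = y l + h * a by rewrite /y -natr1; ring.
  by apply: gauss_le_G; rewrite ha mulr_gt0.
rewrite -mulr_sumr telescope_sumr // ler_pM2l //.
by have /andP[_] := G_bound (y K.*2.+1); have /andP[] := G_bound (y 0%N); lra.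
Qed.

(** Only the first coordinate of L^T v - s involves the first coordinate of v,
    so that the latter can be summed out by [gauss_sum1], whatever the others are. *)
Lemma gauss_sum_trig m (L : 'M[R]_m) (s : 'cV[R]_m) h K :
  is_trig_mx L -> (forall i, 0 < L i i) -> (forall i, h * L i i <= 1) -> 0 < h ->
  h ^+ m * \sum_(v <- grid (line_grid h K) m) expR (- sqnorm (L^T *m v - s)) <=
  8 ^+ m / \prod_i L i i.
Proof.
move=> tL pL hL h0; elim: m L s tL pL hL => [|m IH] L s tL pL hL.
  by rewrite !expr0 !big_ord0 big_grid0 /sqnorm big_ord0 oppr0 expR0 divr1 mulr1.
rewrite -[m.+1]/(1 + m)%N in L s tL pL hL *.
pose a := L (lshift m 0) (lshift m 0).
pose L' : 'M[R]_m := drsubmx L.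
have /and3P[/eqP ur0 _ tL'] : [&& ursubmx L == 0, is_trig_mx (ulsubmx L) & is_trig_mx L'].
  by move: (tL); rewrite -{1}[L]submxK is_trig_block_mx.
have LE : L = block_mx a%:M 0 (dlsubmx L) L'.
  by rewrite -[LHS]submxK ur0; congr block_mx; rewrite [LHS]mx11_scalar !mxE.
have L'E i : L' i i = L (rshift 1 i) (rshift 1 i) by rewrite !mxE.
have a0 : 0 < a := pL _.
have ha : h * a <= 1 := hL _.
have aE : L (lshift m ord0) (lshift m ord0) = a by [].
have := IH L' (dsubmx s) tL'; clearbody a.
have pL' i : 0 < L' i i by rewrite L'E.
have hL' i : h * L' i i <= 1 by rewrite L'E.
move=> /(_ pL' hL').
rewrite big_split_ord big_ord1 /= aE.
have -> : \prod_i L (rshift 1 i) (rshift 1 i) = \prod_i L' i i.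
  by apply: eq_bigr => i _; rewrite L'E.
set D := \prod_i _ => IHs.
have D0 : 0 < D by apply: prodr_gt0 => i _.
rewrite exprS big_gridS exchange_big /=.
have sqE v x : sqnorm (L^T *m (col_mx x%:M v) - s) =
  (a * x + ((dlsubmx L)^T *m v - usubmx s) 0 0) ^+ 2 + sqnorm (L'^T *m v - dsubmx s).
  rewrite {1}LE tr_block_mx trmx0 tr_scalar_mx mul_block_col mul0mx add0r.
  rewrite -{1}[s]vsubmxK opp_col_mx add_col_mx -scalar_mxM -addrA.
  by rewrite [X in _ + X]mx11_scalar -raddfD /= sqnorm_col.
rewrite mulr_sumr.
apply: (@le_trans _ _ (\sum_(v <- grid (line_grid h K) m)
   (8 / a) * (h ^+ m * expR (- sqnorm (L'^T *m v - dsubmx s))))).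
  apply: ler_sum => v _; under eq_bigr do rewrite sqE opprD expRD.
  rewrite -mulr_suml; set e := expR _; set S := \sum_(x <- _) _.
  have -> : h * h ^+ m * (S * e) = h * S * (h ^+ m * e) by ring.
  rewrite ler_wpM2r ?gauss_sum1 // mulr_ge0 ?expR_ge0 //.
  by rewrite exprn_ge0 // ltW.
rewrite -2!mulr_sumr exprS invfM [leRHS]mulrACA ler_pM2l //.
by rewrite divr_gt0.
Qed.

(** The discrete counterpart of the Gaussian integral: up to the constant 8 per
    dimension it only depends on the determinant.  The factor U is replaced by
    the triangular Cholesky factor of U^T U, which gives the same norms up to a
    translation of s.  The threshold h0 depends on U but neither on the centre s
    nor on the extent K of the grid. *)
Lemma gauss_sum_det m (U : 'M[R]_m) : \det U != 0 ->
  exists2 h0, 0 < h0 & forall h K s, 0 < h <= h0 ->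
  h ^+ m * \sum_(v <- grid (line_grid h K) m) expR (- sqnorm (U *m v - s)) <=
  8 ^+ m / `|\det U|.
Proof.
move=> U0; have Uu : U \in unitmx by rewrite unitmxE unitfE.
have [||L [tL pL LE]] := @cholesky R m (U^T *m U).
- by rewrite trmx_mul trmxK.
- move=> x x0; rewrite mulmxA -trmx_mul -mulmxA -sqnormE lt_neqAle sqnorm_ge0 andbT.
  rewrite eq_sym; apply: contraNneq x0 => /sqnorm_eq0 Ux0.
  by rewrite -(mulKmx Uu x) Ux0 mulmx0.
have dL : \prod_i L i i = `|\det U|.
  apply/eqP; rewrite -(@eqrXn2 _ 2) ?prodr_ge0 // => [|i _]; last exact: ltW.
  rewrite -det_trig // real_normK ?num_real // expr2 -{2}(det_tr L) -det_mulmx LE.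
  by rewrite det_mulmx det_tr expr2.
have S0 : 0 <= \sum_i L i i by apply: sumr_ge0 => i _; exact: ltW.
exists (1 + \sum_i L i i)^-1 => [|h K s /andP[h0 hh]]; first by rewrite invr_gt0; lra.
have hL i : h * L i i <= 1.
  apply: (@le_trans _ _ ((1 + \sum_i L i i)^-1 * (1 + \sum_i L i i))).
    apply: ler_pM => //; first exact: ltW.
    - exact: ltW.
    - rewrite (bigD1 i) //=.
      have : 0 <= \sum_(j | j != i) L j j by apply: sumr_ge0 => j _; exact: ltW.
      by lra.
  by rewrite mulVf // gt_eqF //; lra.
have := gauss_sum_trig (L^T *m invmx U *m s) K tL pL hL h0; rewrite dL.
congr (_ * _ <= _); apply: eq_bigr => v _; congr (expR (- _)).
have -> : L^T *m v - L^T *m invmx U *m s = L^T *m (v - invmx U *m s).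
  by rewrite mulmxBr mulmxA.
have -> : U *m v - s = U *m (v - invmx U *m s) by rewrite mulmxBr mulKVmx.
rewrite !sqnormE !trmx_mul trmxK -!mulmxA.
by rewrite [L *m _]mulmxA LE !mulmxA.
Qed.

End Grid.

(** * Powers of cosines as binomial averages of characters *)

Section Kernel.
Variable R : realType.

Lemma sum_pascal N (F : nat -> R) :
  \sum_(l < N.+2) 'C(N.+1, l)%:R * F l =
  \sum_(l < N.+1) 'C(N, l)%:R * (F l + F l.+1).
Proof.
under [RHS]eq_bigr do rewrite mulrDr.
rewrite big_split /= big_ord_recl bin0 /=.
under eq_bigr do rewrite /bump /= add1n binS natrD mulrDl.
rewrite big_split /= addrA; congr (_ + _).
rewrite big_ord_recr /= bin_small // mul0r addr0.
by rewrite [RHS]big_ord_recl bin0 /=.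
Qed.

(** The binomial expansion of ((e^(iy) + e^(-iy)) / 2)^N, in real form. *)
Lemma cos_pow_binomial N (a y : R) :
  \sum_(l < N.+1) 'C(N, l)%:R / 2 ^+ N * cos (a + (2 * l%:R - N%:R) * y) =
  cos a * cos y ^+ N.
Proof.
elim: N a => [|N IH] a.
  by rewrite big_ord1 bin0 expr0 divr1 mul1r mulr1 mulr0 subr0 mul0r addr0.
transitivity (2^-1 * (cos (a + y) * cos y ^+ N + cos (a - y) * cos y ^+ N)); last first.
  by rewrite -mulrDl cosD cosB exprS; field.
rewrite -!IH -big_split mulr_sumr /=.
under eq_bigr do rewrite -mulrA.
rewrite (sum_pascal N (fun l =>
  (2 ^+ N.+1)^-1 * cos (a + (2 * l%:R - N.+1%:R) * y))).
apply: eq_bigr => l _.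
have nE n : n.+1%:R = n%:R + 1 :> R by rewrite natr1.
rewrite !exprS (nE N) (nE l).
have -> : a + (2 * l%:R - (N%:R + 1)) * y = a - y + (2 * l%:R - N%:R) * y by ring.
have -> : a + (2 * (l%:R + 1) - (N%:R + 1)) * y = a + y + (2 * l%:R - N%:R) * y by ring.
by field; rewrite expf_neq0.
Qed.

Lemma central_bin_ratio K :
  'C(K.+1.*2, K.+1)%:R * (2 * K%:R + 2) = 'C(K.*2, K)%:R * (2 * (2 * K%:R + 1)) * 2 :> R.
Proof.
have c0 : K%:R + 1 != 0 :> R by rewrite natr1 pnatr_eq0.
have E1 : (K%:R + 1) * 'C(K.+1.*2, K.+1)%:R = (2 * K%:R + 2) * 'C(K.*2.+1, K)%:R :> R.
  rewrite natr1 -natrM -mul_bin_diag natrM doubleS /=; congr (_ * _).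
  by rewrite -doubleS -mul2n natrM -natr1; ring.
have E2 : (K%:R + 1) * 'C(K.*2.+1, K)%:R = (2 * K%:R + 1) * 'C(K.*2, K)%:R :> R.
  rewrite natr1 -natrM.
  have -> : (K.+1 * 'C(K.*2.+1, K) = K.*2.+1 * 'C(K.*2, K))%N.
    by rewrite mul_bin_down -addnn subSn ?leq_addr // addnK.
  by rewrite natrM -natr1 -mul2n natrM.
apply: (mulfI c0); apply: (mulfI c0).
rewrite [_ * (_ * (2 * _ + 2))]mulrA E1 !mulrA.
by move: E2; set c := 'C(_, _)%:R; set c' := 'C(_, _)%:R => E2; nra.
Qed.

(** The bound 4^K / sqrt K on the central coefficient follows by induction from
    its slight strengthening with 2 K + 1 in place of K. *)
Lemma central_bin_le K : 'C(K.*2, K)%:R / 4 ^+ K * Num.sqrt K%:R <= 1 :> R.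
Proof.
have main : ('C(K.*2, K)%:R / 4 ^+ K) ^+ 2 * (2 * K%:R + 1) <= 1 :> R.
  elim: K => [|K IH]; first by rewrite bin0 expr0 mulr0 add0r divr1 mulr1 expr1n.
  have k0 : 0 <= K%:R :> R := ler0n _ _.
  have -> : 'C(K.+1.*2, K.+1)%:R / 4 ^+ K.+1 =
     'C(K.*2, K)%:R / 4 ^+ K * ((2 * K%:R + 1) / (2 * K%:R + 2)) :> R.
    have := central_bin_ratio K; set c := 'C(K.+1.*2, K.+1)%:R; move=> cE.
    have -> : c = 'C(K.*2, K)%:R * (2 * (2 * K%:R + 1)) * 2 / (2 * K%:R + 2).
      by rewrite -cE mulfK // gt_eqF //; lra.
    by rewrite exprS; field; rewrite expf_neq0 //= gt_eqF //; lra.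
  apply: le_trans IH; set c := _ / _; rewrite exprMn -mulrA.
  rewrite ler_wpM2l ?sqr_ge0 // expr_div_n mulrAC ler_pdivrMr; last by nra.
  by rewrite -natr1; nra.
set c := _ / _ in main *; have c0 : 0 <= c by rewrite divr_ge0.
rewrite -(@expr_le1 _ 2) ?mulr_ge0 ?sqrtr_ge0 // exprMn sqr_sqrtr ?ler0n //.
apply: le_trans main; rewrite ler_wpM2l ?sqr_ge0 //.
by have := ler0n R K; lra.
Qed.

(** Each ratio of successive coefficients is 1 - (2 j + 1) / (K + j + 1), hence
    at most exp (- (2 j + 1) / (2 K)), and the odd numbers add up to a square. *)
Lemma bin_gauss K j : (j <= K)%N ->
  'C(K.*2, K + j)%:R <= 'C(K.*2, K)%:R * expR (- (j%:R ^+ 2 / (2 * K%:R))) :> R.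
Proof.
elim: j => [|j IH] jK.
  by rewrite addn0 expr0n mul0r oppr0 expR0 mulr1.
have K0 : 0 < K%:R :> R by rewrite ltr0n; apply: leq_ltn_trans jK.
have jK' : j%:R + 1 <= K%:R :> R by rewrite natr1 ler_nat.
have j0 : 0 <= j%:R :> R := ler0n _ _.
have rE : 'C(K.*2, K + j.+1)%:R =
    'C(K.*2, K + j)%:R * (1 - (2 * j%:R + 1) / (K%:R + j%:R + 1)) :> R.
  have E : (K + j).+1%:R * 'C(K.*2, K + j.+1)%:R =
      (K%:R - j%:R) * 'C(K.*2, K + j)%:R :> R.
    by rewrite -natrB 1?ltnW // -!natrM addnS mul_bin_left -addnn subnDl.
  have dE : (K + j).+1%:R = K%:R + j%:R + 1 :> R by rewrite -natr1 natrD.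
  have d0 : K%:R + j%:R + 1 != 0 :> R by rewrite gt_eqF //; lra.
  by apply: (mulfI d0); rewrite -{1}dE E; field.
rewrite rE; apply: (@le_trans _ _ ('C(K.*2, K + j)%:R * expR (- ((2 * j%:R + 1) / (2 * K%:R))))).
  rewrite ler_wpM2l //; apply: (@le_trans _ _ (1 - (2 * j%:R + 1) / (2 * K%:R))).
    rewrite lerD2l lerN2 ler_wpM2l ?lef_pV2 ?posrE; lra.
  exact: expR_ge1Dx.
apply: (@le_trans _ _ ('C(K.*2, K)%:R * expR (- (j%:R ^+ 2 / (2 * K%:R))) *
         expR (- ((2 * j%:R + 1) / (2 * K%:R))))).
  by rewrite ler_wpM2r ?expR_ge0 // IH // ltnW.
rewrite -mulrA -expRD ler_wpM2l // ler_expR -natr1.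
by rewrite le_eqVlt; apply/orP; left; apply/eqP; field; rewrite gt_eqF.
Qed.

(** The binomial weight of the grid point x = h (l - K), as a function of x; the
    index l is recovered as the integer part of x / h + K. *)
Definition binomial_weight (h : R) K (x : R) : R :=
  'C(K.*2, Num.truncn (x / h + K%:R))%:R / 4 ^+ K.

Lemma binomial_weightE h K l : 0 < h ->
  binomial_weight h K (h * (l%:R - K%:R)) = 'C(K.*2, l)%:R / 4 ^+ K.
Proof.
move=> h0; rewrite /binomial_weight mulrAC mulfV ?gt_eqF // mul1r subrK.
by rewrite (_ : Num.truncn l%:R = l) //; apply: truncn_def; rewrite lexx ltr_nat ltnSn.
Qed.

Lemma binomial_weight_ge0 h K x : 0 <= binomial_weight h K x.
Proof. by rewrite divr_ge0. Qed.

(** With the step h = 1 / (eta sqrt K) the binomial law on the grid has standard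
    deviation of order 1 / eta, and is bounded by h times a Gaussian density. *)
Lemma binomial_weight_le h K x eta : 0 < h -> 0 < eta -> (0 < K)%N ->
  K%:R * (h * eta) ^+ 2 = 1 -> x \in line_grid h K ->
  binomial_weight h K x <= h * eta * expR (- (eta ^+ 2 * x ^+ 2 / 2)).
Proof.
move=> h0 e0 K0 KE /mapP[l]; rewrite mem_iota add0n ltnS => /= lK ->.
have k0 : 0 < K%:R :> R by rewrite ltr0n.
have he0 : 0 < h * eta by rewrite mulr_gt0.
have sE : (h * eta)^-1 = Num.sqrt K%:R.
  apply/eqP; rewrite -(@eqrXn2 _ 2) ?sqrtr_ge0 ?invr_ge0 1?ltW //.
  have he2 : (h * eta) ^+ 2 != 0 by rewrite expf_neq0 // gt_eqF.
  by apply/eqP/(mulIf he2); rewrite sqr_sqrtr 1?ltW // KE exprVn mulVf.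
rewrite binomial_weightE //.
have [j jK [jE lE]] : exists2 j, (j <= K)%N & ((l%:R - K%:R) ^+ 2 = j%:R ^+ 2 :> R)
    /\ 'C(K.*2, l) = 'C(K.*2, K + j).
  have [Kl|lK'] := leqP K l.
    exists (l - K)%N; first by rewrite leq_subLR addnn.
    by rewrite natrB // subnKC.
  exists (K - l)%N; first exact: leq_subr.
  split; first by rewrite natrB 1?ltnW // -sqrrN opprB.
  rewrite -bin_sub // -addnn -addnBA //; exact: ltnW.
have := central_bin_le K; rewrite -sE ler_pdivrMr // mul1r => cb.
rewrite lE; have -> : eta ^+ 2 * (h * (l%:R - K%:R)) ^+ 2 / 2 = j%:R ^+ 2 / (2 * K%:R).
  have k0' : K%:R != 0 :> R by rewrite gt_eqF.
  have -> : j%:R ^+ 2 / (2 * K%:R) = j%:R ^+ 2 * (K%:R * (h * eta) ^+ 2) / (2 * K%:R) :> R.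
    by rewrite KE mulr1.
  by rewrite exprMn jE; field.
apply: le_trans (ler_wpM2r (expR_ge0 _) cb).
by rewrite mulrAC ler_wpM2r ?invr_ge0 ?exprn_ge0 // bin_gauss.
Qed.

Lemma sum_binomial_weight_cos h K a x : 0 < h ->
  \sum_(t <- line_grid h K) binomial_weight h K t * cos (a + t * x) =
  cos a * cos (h * x / 2) ^+ K.*2.
Proof.
move=> h0; rewrite big_line_grid -cos_pow_binomial; apply: eq_bigr => l _.
have pE : 2 ^+ K.*2 = 4 ^+ K :> R by rewrite -mul2n exprM expr2 -natrM.
have KE : K.*2%:R = 2 * K%:R :> R by rewrite -mul2n natrM.
by rewrite binomial_weightE // pE KE; congr (_ * cos _); field.
Qed.

(** A product of cosine powers is nonnegative, and is an average of characters
    over the grid with nonnegative weights; it plays the role of a Gaussian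
    window and its Fourier transform. *)
Lemma sum_grid_cos h K m a (x : 'cV[R]_m) : 0 < h ->
  \sum_(t <- grid (line_grid h K) m) (\prod_j binomial_weight h K (t j 0)) * cos (a + dotp t x) =
  cos a * \prod_j cos (h * x j 0 / 2) ^+ K.*2.
Proof.
move=> h0; elim: m a x => [|m IH] a x.
  by rewrite big_grid0 !big_ord0 mul1r mulr1 /dotp big_ord0 addr0.
rewrite -[m.+1]/(1 + m)%N in x *.
rewrite big_gridS.
transitivity (\sum_(y <- line_grid h K) binomial_weight h K y * cos (a + y * x 0 0) *
    \prod_j cos (h * dsubmx x j 0 / 2) ^+ K.*2).
  apply: eq_bigr => y _; rewrite -mulrA -IH mulr_sumr; apply: eq_bigr => v _.
  rewrite dotp_col addrA big_split_ord big_ord1 /= col_mxEu mxE eqxx mulr1n.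
  rewrite -mulrA; congr (_ * (_ * _)).
  by apply: eq_bigr => j _; rewrite col_mxEd.
rewrite -mulr_suml sum_binomial_weight_cos // big_split_ord big_ord1 /= -mulrA.
congr (_ * (cos (h * x _ _ / 2) ^+ _ * _)); first exact: val_inj.
by apply: eq_bigr => j _; rewrite mxE.
Qed.

Lemma prod_binomial_weight_le h K m (t : 'cV[R]_m) eta : 0 < h -> 0 < eta -> (0 < K)%N ->
  K%:R * (h * eta) ^+ 2 = 1 -> t \in grid (line_grid h K) m ->
  \prod_j binomial_weight h K (t j 0) <=
  eta ^+ m * (h ^+ m * expR (- (eta ^+ 2 * sqnorm t / 2))).
Proof.
move=> h0 e0 K0 KE /mem_grid tg.
apply: (@le_trans _ _ (\prod_j (h * eta * expR (- (eta ^+ 2 * t j 0 ^+ 2 / 2))))).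
  by apply: ler_prod => j _; rewrite binomial_weight_ge0 binomial_weight_le.
rewrite big_split /= prodr_const card_ord -expR_sum exprMn mulrA [eta ^+ m * _]mulrC.
rewrite ler_wpM2l //; first by rewrite mulr_ge0 ?exprn_ge0 // ltW.
by rewrite ler_expR sumrN lerN2 /sqnorm mulr_sumr mulr_suml.
Qed.

(** In the ball of squared radius 4 eta^2 m all the arguments of the cosines are
    at most 1 in absolute value as soon as K >= m; there cos y >= exp (- y^2). *)
Lemma cos_kernel_lower h K m (x : 'cV[R]_m) eta : 0 < h -> 0 < eta ->
  K%:R * (h * eta) ^+ 2 = 1 -> (m <= K)%N -> sqnorm x <= 4 * eta ^+ 2 * m%:R ->
  expR (- (2 * m%:R)) <= \prod_j cos (h * x j 0 / 2) ^+ K.*2.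
Proof.
move=> h0 e0 KE mK xm.
have K0 : K%:R != 0 :> R.
  by apply/eqP => k0; move: KE; rewrite k0 mul0r => /eqP; rewrite eq_sym oner_eq0.
have Kp : 0 < K%:R :> R by rewrite lt_neqAle eq_sym K0 ler0n.
have mK' : m%:R <= K%:R :> R by rewrite ler_nat.
have hE : h ^+ 2 = (eta ^+ 2 * K%:R)^-1.
  have ee : eta ^+ 2 != 0 by rewrite expf_neq0 // gt_eqF.
  have eK := mulf_neq0 ee K0.
  apply: (mulIf eK); rewrite (mulVf eK) -[RHS]KE exprMn; ring.
have sj j : (h * x j 0 / 2) ^+ 2 <= 1.
  apply: (@le_trans _ _ (h ^+ 2 * sqnorm x / 4)).
    have -> : (h * x j 0 / 2) ^+ 2 = h ^+ 2 * (x j 0) ^+ 2 / 4 by field.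
    rewrite ler_pM2r // ler_wpM2l ?sqr_ge0 // /sqnorm (bigD1 j) //= lerDl.
    by apply: sumr_ge0 => i _; rewrite sqr_ge0.
  rewrite hE ler_pdivrMr // mul1r mulrC ler_pdivrMr ?mulr_gt0 ?exprn_gt0 //.
  by apply: (le_trans xm); rewrite -mulrA ler_pM2l // ler_pM2l ?exprn_gt0.
apply: (@le_trans _ _ (\prod_j expR (- (h ^+ 2 * x j 0 ^+ 2 / 4)) ^+ K.*2)).
  under eq_bigr do rewrite -expRM_natl.
  rewrite -expR_sum ler_expR -mulr_sumr sumrN mulrN lerN2 -mulr_suml -mulr_sumr -/(sqnorm x).
  rewrite hE -mul2n natrM; set q := (X in X <= _).
  have -> : q = sqnorm x / eta ^+ 2 / 2 by rewrite /q; field; rewrite K0 gt_eqF.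
  by rewrite ler_pdivrMr // ler_pdivrMr ?exprn_gt0 //; lra.
apply: ler_prod => j _; rewrite exprn_ge0 ?expR_ge0 //=.
have := sj j; have := cos_ge_quadratic (h * x j 0 / 2).
have -> : h ^+ 2 * x j 0 ^+ 2 / 4 = (h * x j 0 / 2) ^+ 2 by field.
set y := h * _ / 2 => cy y1.
have ye : expR (- y ^+ 2) <= cos y.
  by apply: le_trans cy; apply: expRN_le_half; rewrite sqr_ge0.
by rewrite lerXn2r ?nnegrE ?expR_ge0 // (le_trans (expR_ge0 _) ye).
Qed.

End Kernel.

(** * A weak Brascamp-Lieb inequality *)

Section BL.
Variable R : realType.

Lemma convex_comb_gt0 (I : finType) (p y : I -> R) :
  (forall i, 0 <= p i) -> \sum_i p i = 1 -> (forall i, p i != 0 -> 0 < y i) ->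
  0 < \sum_i p i * y i.
Proof.
move=> p0 p1 yp.
have py0 i : 0 <= p i * y i.
  have [->|/yp/ltW] := eqVneq (p i) 0; first by rewrite mul0r.
  exact: mulr_ge0.
rewrite lt_neqAle sumr_ge0 ?andbT // eq_sym psumr_eq0 //; apply/negP => /allP h0.
have /eqP : \sum_i p i = 0.
  apply: big1 => i _; apply/eqP; apply: contraTT (h0 i (mem_index_enum i)) => pi0.
  by rewrite /= mulf_eq0 negb_or pi0 gt_eqF ?yp.
by rewrite p1 oner_eq0.
Qed.

(** Jensen's inequality for the logarithm, where y may be nonpositive at points
    of weight 0. *)
Lemma jensen_ln (I : finType) (p y : I -> R) :
  (forall i, 0 <= p i) -> \sum_i p i = 1 -> (forall i, p i != 0 -> 0 < y i) ->
  \sum_i p i * ln (y i) <= ln (\sum_i p i * y i).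
Proof.
move=> p0 p1 yp; have Y0 := convex_comb_gt0 p0 p1 yp; set Y := \sum_i _ in Y0 *.
have -> : ln Y = \sum_i p i * (ln Y + (y i / Y - 1)).
  under eq_bigr do rewrite mulrDr mulrBr mulr1 mulrA.
  rewrite big_split /= -mulr_suml p1 mul1r sumrB -mulr_suml -/Y p1.
  by rewrite divff ?gt_eqF // subrr addr0.
apply: ler_sum => i _; have [->|pi0] := eqVneq (p i) 0; first by rewrite !mul0r.
rewrite ler_wpM2l // -lerBlDl.
have yi0 := yp i pi0.
rewrite -ln_div ?posrE //; apply: le_trans (le_ln1Dx _).
  by rewrite addrC subrK.
by rewrite ltrBrDl subrr divr_gt0.
Qed.

Variables (m n : nat) (W : 'M[R]_(m, n)).
Hypothesis W1 : W *m W^T = 1%:M.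

Let c i := \sum_j W j i ^+ 2.

Lemma sum_col_sqnorm : \sum_i c i = m%:R.
Proof.
rewrite exchange_big /= -[RHS]mxtrace1 -W1; apply: eq_bigr => j _.
by rewrite mxE; apply: eq_bigr => i _; rewrite mxE expr2.
Qed.

Lemma col_sqnorm_gt0 f : \det (colsub f W) != 0 -> forall j : 'I_m, 0 < c (f j).
Proof.
move=> d0 j; rewrite lt_neqAle sumr_ge0 ?andbT => [|k _]; last exact: sqr_ge0.
apply: contraNneq d0 => /esym/eqP; rewrite psumr_eq0 => [/allP h0|k _]; last exact: sqr_ge0.
rewrite (expand_det_col _ j) big1 // => k _.
by have := h0 k (mem_index_enum k); rewrite /= sqrf_eq0 mxE => /eqP ->; rewrite mul0r.
Qed.

(** The volume spanned by the normalised columns of W picked by f. *)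
Definition basis_volume f : R :=
  `|\det (colsub f W)| / \prod_(j < m) Num.sqrt (c (f j)).

Lemma natX_le_fact_expR k : k%:R ^+ k / k`!%:R <= expR k%:R :> R.
Proof.
case: k => [|k]; first by rewrite expr0 fact0 divr1 expR0.
by have := @expR_ge1Dxn R k.+1%:R k (ler0n _ _); lra.
Qed.

(** Since f picks i on average c i times, the exponent on the left is the mean
    over f of the sums of E over f.  Jensen's inequality moves the mean out of
    the exponential once the factor [basis_volume W f] is introduced, at the
    cost of the mean of - ln (basis_volume W f).  Applying Jensen again to the
    inverse squares of the volumes bounds this cost by ln (m^m / m!) / 2. *)
Lemma weak_brascamp_lieb (E : 'I_n -> R) :
  expR (- \sum_i c i * E i) <=
  expR (m%:R / 2) * \sum_f basis_weight W f *
                      (basis_volume f * expR (- \sum_j E (f j))).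
Proof.
pose p := basis_weight W; have p0 f : 0 <= p f := basis_weight_ge0 W f.
have p1 : \sum_f p f = 1 := basis_weight_sum1 W1.
have pd f : p f != 0 -> \det (colsub f W) != 0.
  by apply: contraNneq => d0; rewrite /p /basis_weight d0 expr0n /= mul0r.
have vol0 f : p f != 0 -> 0 < basis_volume f.
  move=> /pd d0; rewrite divr_gt0 ?normr_gt0 // prodr_gt0 // => j _.
  by rewrite sqrtr_gt0 col_sqnorm_gt0.
pose x (f : {ffun 'I_m -> 'I_n}) := \sum_j E (f j).
have xE : \sum_i c i * E i = \sum_f p f * x f.
  under eq_bigr => i _ do rewrite /c -(basis_weight_marginal W1) mulr_suml.
  rewrite exchange_big; apply: eq_bigr => f _ /=.
  under eq_bigr => i _ do rewrite -mulrA mulr_suml.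
  rewrite -mulr_sumr exchange_big /=; congr (_ * _); apply: eq_bigr => j _.
  rewrite (bigD1 (f j)) //= eqxx mul1r big1 ?addr0 // => i.
  by rewrite eq_sym => /negPf ->; rewrite mul0r.
have y0 f : p f != 0 -> 0 < basis_volume f * expR (- x f).
  by move=> pf; rewrite mulr_gt0 ?expR_gt0 ?vol0.
have J := jensen_ln p0 p1 y0; have Y0 := convex_comb_gt0 p0 p1 y0.
set Y := (X in ln X) in J; rewrite -/Y in Y0.
have inv2 f : p f != 0 -> 0 < (basis_volume f) ^- 2.
  by move=> pf; rewrite invr_gt0 exprn_gt0 ?vol0.
have J2 := jensen_ln p0 p1 inv2.
(* The weight p f cancels the determinant in the inverse square of the volume,
   and the products of the c (f j) add up to (sum_i c i)^m = m^m. *)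
have S2 : \sum_f p f * (basis_volume f) ^- 2 <= expR m%:R.
  apply: le_trans (natX_le_fact_expR m).
  have -> : m%:R ^+ m = \sum_(f : {ffun 'I_m -> 'I_n}) \prod_j c (f j).
    by rewrite -(bigA_distr_bigA (fun=> c)) /= prodr_const card_ord sum_col_sqnorm.
  rewrite mulr_suml ler_sum // => f _.
  have c0 : 0 <= \prod_(j < m) c (f j) / m`!%:R.
    rewrite divr_ge0 // prodr_ge0 // => j _; apply: sumr_ge0 => k _; exact: sqr_ge0.
  have [->|/pd d0] := eqVneq (p f) 0; first by rewrite mul0r.
  rewrite /p /basis_weight /basis_volume expr_div_n real_normK ?num_real // -prodrXl.
  have -> : \prod_(j < m) Num.sqrt (c (f j)) ^+ 2 = \prod_(j < m) c (f j).
    by apply: eq_bigr => j _; rewrite sqr_sqrtr // ltW ?col_sqnorm_gt0.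
  move: (\prod_(j < m) c (f j)) c0 => C C0.
  rewrite invf_div.
  have d2 : \det (colsub f W) ^+ 2 != 0 by rewrite expf_neq0.
  rewrite le_eqVlt; apply/orP; left; apply/eqP; field.
  by rewrite d0 pnatr_eq0 -lt0n fact_gt0.
have halves : \sum_f p f * ln ((basis_volume f) ^- 2) = - (2 * \sum_f p f * ln (basis_volume f)).
  rewrite mulr_sumr -sumrN; apply: eq_bigr => f _.
  have [->|pf] := eqVneq (p f) 0; first by rewrite !mul0r mulr0 oppr0.
  by rewrite lnV ?posrE ?exprn_gt0 ?vol0 // lnXn ?vol0 // -mulr_natr; ring.
have splitJ : \sum_f p f * ln (basis_volume f * expR (- x f)) =
    \sum_f p f * ln (basis_volume f) - \sum_f p f * x f.
  rewrite -sumrB; apply: eq_bigr => f _.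
  have [->|pf] := eqVneq (p f) 0; first by rewrite !mul0r subrr.
  by rewrite lnM ?posrE ?expR_gt0 ?vol0 // expRK; ring.
have lnm : ln (\sum_f p f * (basis_volume f) ^- 2) <= m%:R.
  rewrite -[leRHS]expRK ler_ln ?posrE ?expR_gt0 //.
  exact: (convex_comb_gt0 p0 p1 inv2).
have -> : \sum_f basis_weight W f * (basis_volume f * expR (- \sum_j E (f j))) = Y by [].
rewrite xE -[Y]lnK ?posrE // -expRD ler_expR.
by move: J J2; rewrite halves splitJ; lra.
Qed.
End BL.

(** * Characteristic functions of finitely supported variables *)

Section CharFun.
Variable R : realType.

(** The squared modulus of the characteristic function at t of a variable with
    values v and probabilities p, that is, the expectation of cos (t (X - X'))
    for an independent copy X' of X ([charfun_sqE]). *)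
Definition charfun_sq (I : finType) (p v : I -> R) (t : R) : R :=
  \sum_k \sum_l p k * p l * cos (t * (v k - v l)).

Lemma charfun_sqE (I : finType) (p v : I -> R) t :
  charfun_sq p v t = (\sum_k p k * cos (t * v k)) ^+ 2 + (\sum_k p k * sin (t * v k)) ^+ 2.
Proof.
rewrite !expr2 !mulr_suml -big_split /=; apply: eq_bigr => k _.
rewrite !mulr_sumr -big_split /=; apply: eq_bigr => l _.
by rewrite mulrBr cosB; ring.
Qed.

Definition cis (t : R) : R[i] := Complex (cos t) (sin t).

Lemma cisD s t : cis (s + t) = cis s * cis t.
Proof. by rewrite /cis cosD sinD; congr Complex; ring. Qed.

Lemma cis0 : cis 0 = 1.
Proof. by rewrite /cis cos0 sin0. Qed.

Lemma normc_cis t : Normc.normc (cis t) = 1.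
Proof. by rewrite /= cos2Dsin2 sqrtr1. Qed.

Lemma Re_le_normc (z : R[i]) : complex.Re z <= Normc.normc z.
Proof.
case: z => a b /=; apply: le_trans (ler_norm a) _.
by rewrite -sqrtr_sqr ler_wsqrtr // lerDl sqr_ge0.
Qed.

Lemma Re_sum (I : finType) (F : I -> R[i]) :
  complex.Re (\sum_i F i) = \sum_i complex.Re (F i).
Proof. by apply: (big_morph (@complex.Re R)) => // -[a b] [c d]. Qed.

Lemma Im_sum (I : finType) (F : I -> R[i]) :
  complex.Im (\sum_i F i) = \sum_i complex.Im (F i).
Proof. by apply: (big_morph (@complex.Im R)) => // -[a b] [c d]. Qed.

(** The left-hand side is the real part of a unit complex number times the
    product of the characteristic functions. *)
Lemma expect_cos_le (I : finType) n (p v : 'I_n -> I -> R) (s : 'I_n -> R) a :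
  \sum_(x : {ffun 'I_n -> I}) (\prod_i p i (x i)) *
     cos (\sum_i s i * v i (x i) + a) <=
  \prod_i Num.sqrt (charfun_sq (p i) (v i) (s i)).
Proof.
pose z i k : R[i] := Complex (p i k) 0 * cis (s i * v i k).
have prodC (f : 'I_n -> R) :
    \prod_i (Complex (f i) 0 : R[i]) = Complex (\prod_i f i) 0.
  apply/esym/(big_morph (fun r : R => Complex r 0 : R[i])) => // x y.
  by congr Complex; ring.
have prodcis (f : 'I_n -> R) : \prod_i cis (f i) = cis (\sum_i f i).
  by rewrite (big_morph cis cisD cis0).
have zE : cis a * \prod_i \sum_k z i k = \sum_(x : {ffun 'I_n -> I})
    Complex (\prod_i p i (x i)) 0 * cis (\sum_i s i * v i (x i) + a).
  rewrite bigA_distr_bigA mulr_sumr; apply: eq_bigr => x _ /=.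
  by rewrite big_split /= prodC prodcis cisD mulrC mulrA.
have -> : \sum_(x : {ffun 'I_n -> I}) (\prod_i p i (x i)) *
     cos (\sum_i s i * v i (x i) + a) = complex.Re (cis a * \prod_i \sum_k z i k).
  rewrite zE Re_sum; apply: eq_bigr => x _ /=.
  by rewrite mul0r subr0.
apply: le_trans (Re_le_normc _) _.
rewrite Normc.normcM normc_cis mul1r.
rewrite (big_morph _ (@Normc.normcM R) (Normc.normc1 R)) le_eqVlt; apply/orP; left.
apply/eqP/eq_bigr => i _; rewrite charfun_sqE.
have -> : \sum_k z i k = Complex (\sum_k p i k * cos (s i * v i k))
    (\sum_k p i k * sin (s i * v i k)).
  apply/eqP; rewrite eq_complex Re_sum Im_sum /=; apply/andP; split; apply/eqP;
  apply: eq_bigr => k _ /=; ring.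
by [].
Qed.

Lemma one_sub_cosB (x y : R) :
  1 - cos (x - y) <= 2 * (1 - cos x) + 2 * (1 - cos y).
Proof.
rewrite (cos_half (x - y)) (cos_half x) (cos_half y) mulrBl sinB.
have := cos2Dsin2 (x / 2); have := cos2Dsin2 (y / 2).
set cx := cos (x / 2); set sx := sin (x / 2).
set cy := cos (y / 2); set sy := sin (y / 2) => ey ex.
have h1 : (sx * cy - cx * sy) ^+ 2 <= 2 * (sx * cy) ^+ 2 + 2 * (cx * sy) ^+ 2.
  by have := sqr_ge0 (sx * cy + cx * sy); nra.
have h2 : (sx * cy) ^+ 2 <= sx ^+ 2.
  by rewrite exprMn ler_piMr ?sqr_ge0 //; have := sqr_ge0 sy; lra.
have h3 : (cx * sy) ^+ 2 <= sy ^+ 2.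
  by rewrite exprMn ler_piMl ?sqr_ge0 //; have := sqr_ge0 sx; lra.
lra.
Qed.

Section Peaks.
Variables (I : finType) (p v : I -> R).
Hypotheses (p0 : forall k, 0 <= p k) (p1 : \sum_k p k = 1).

Lemma sum_pairs1 : \sum_k \sum_l p k * p l = 1.
Proof. by under eq_bigr do rewrite -mulr_sumr p1 mulr1. Qed.

Lemma one_sub_charfun_sq t :
  1 - charfun_sq p v t = \sum_k \sum_l p k * p l * (1 - cos (t * (v k - v l))).
Proof.
rewrite -[X in X - _ = _]sum_pairs1 -sumrB; apply: eq_bigr => k _; rewrite -sumrB.
by apply: eq_bigr => l _; ring.
Qed.

(** The approximate subadditivity of 1 - |phi|^2, inherited from that of 1 - cos. *)
Lemma one_sub_charfun_sqB s t :
  1 - charfun_sq p v (s - t) <= 2 * (1 - charfun_sq p v s) + 2 * (1 - charfun_sq p v t).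
Proof.
rewrite !one_sub_charfun_sq !mulr_sumr -big_split ler_sum //= => k _.
rewrite !mulr_sumr -big_split ler_sum //= => l _.
have := one_sub_cosB (s * (v k - v l)) (t * (v k - v l)); rewrite -mulrBl.
by have : 0 <= p k * p l by [exact: mulr_ge0]; nra.
Qed.

Lemma continuous_charfun_sq : continuous (charfun_sq p v).
Proof.
apply: continuous_big => [|k _]; first exact: add_continuous.
apply: continuous_big => [|l _]; first exact: add_continuous.
move=> t; apply: cvgM; first exact: cvg_cst.
apply: continuous_comp; last exact: continuous_cos.
by apply: cvgM; [exact: cvg_id | exact: cvg_cst].
Qed.

Variable delta : R.
Hypotheses (delta0 : 0 < delta)
  (gap : forall u, `|u| <= delta -> u ^+ 2 / 16 <= 1 - charfun_sq p v u).

(** Take for t0 a maximiser of |phi| on the interval.  Then 1 - |phi(t)|^2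
    dominates 1 - |phi(t0)|^2, hence a quarter of 1 - |phi(t - t0)|^2, which is
    quadratic because |t - t0| <= delta. *)
Lemma peak_itv a : exists t0, forall t, a <= t <= a + delta ->
  Num.sqrt (charfun_sq p v t) <= expR (- ((t - t0) ^+ 2 / 128)).
Proof.
have aad : a <= a + delta by rewrite lerDl ltW.
have [|t0 t0in t0max] := @EVT_max R (charfun_sq p v) a (a + delta) aad.
  by apply: continuous_subspaceT; exact: continuous_charfun_sq.
exists t0 => t tin; have := t0max t; rewrite in_itv /= => /(_ tin) tt0.
have d : `|t - t0| <= delta.
  by move: t0in; rewrite in_itv /= => /andP[? ?]; rewrite ler_norml; lra.
have := gap d; have := one_sub_charfun_sqB t t0 => B G.
have E : charfun_sq p v t <= expR (- ((t - t0) ^+ 2 / 64)).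
  by apply: le_trans (expR_ge1Dx _); lra.
apply: le_trans (ler_wsqrtr E) _.
have -> : expR (- ((t - t0) ^+ 2 / 64)) = expR (- ((t - t0) ^+ 2 / 128)) ^+ 2.
  by rewrite -expRM_natl; congr expR; field.
by rewrite sqrtr_sqr ger0_norm ?expR_ge0.
Qed.

(** The line is cut into intervals [l delta, (l + 1) delta] and their opposites,
    indexed by the sign of t and the integer part of |t| / delta. *)
Lemma charfun_peaks : exists tau : bool * nat -> R, forall t,
  Num.sqrt (charfun_sq p v t) <=
  expR (- ((t - tau (0 <= t, Num.truncn (`|t| / delta))) ^+ 2 / 128)).
Proof.
have [tau tauP] := choice (fun bl : bool * nat => peak_itv
   (if bl.1 then bl.2%:R * delta else - (bl.2%:R * delta) - delta)).
exists tau => t; apply: tauP => /=.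
have t0 : 0 <= `|t| / delta by rewrite divr_ge0 // ltW.
have /andP[] := truncn_itv t0; rewrite ler_pdivlMr // ltr_pdivrMr // -natr1 mulrDl mul1r.
by case: (ger0P t) => ? /=; set x := _ * delta; lra.
Qed.

End Peaks.
End CharFun.

(** * The small-ball bound for an isotropic family *)

Lemma finite_common_lb (R : realFieldType) (J : finType) (a : J -> R) :
  (forall j, 0 < a j) -> exists2 e, 0 < e & forall j, e <= a j.
Proof.
move=> a0; exists (\big[Order.min/1]_j a j).
  by apply: lt_bigmin.
by move=> j; apply: bigmin_le.
Qed.

Lemma ler_sum_mem (R : numDomainType) (T : eqType) (r : seq T) (F G : T -> R) :
  (forall x, x \in r -> F x <= G x) -> \sum_(x <- r) F x <= \sum_(x <- r) G x.
Proof. by move=> FG; rewrite big_seq [leRHS]big_seq; exact: ler_sum. Qed.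

Lemma sum_geometric_half_le (R : realFieldType) L : \sum_(l < L) (2^-1 : R) ^+ l <= 2.
Proof.
suff -> : \sum_(l < L) (2^-1 : R) ^+ l = 2 - 2 * 2^-1 ^+ L.
  by rewrite lerBlDr lerDl mulr_ge0 ?exprn_ge0.
elim: L => [|L IH]; first by rewrite big_ord0 expr0; ring.
by rewrite big_ord_recr IH exprS /=; field.
Qed.

Lemma expRN_nat_le (R : realType) l (y : R) : l%:R <= y -> expR (- y) <= 2^-1 ^+ l.
Proof.
move=> ly; rewrite expRN exprVn lef_pV2 ?posrE ?expR_gt0 ?exprn_gt0 //.
have -> : 2 = 1 + 1 :> R by [].
apply: (@le_trans _ _ (expR 1 ^+ l)).
  by rewrite lerXn2r ?nnegrE ?expR_ge0 ?expR_ge1Dx.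
by rewrite -expRM_natl mulr1 ler_expR.
Qed.

Section Discrete.
Variables (R : realType) (I : finType) (n m : nat).
Variables (p v : 'I_n -> I -> R) (W : 'M[R]_(m, n)) (delta rho eta : R).
Hypotheses (p0 : forall i k, 0 <= p i k) (p1 : forall i, \sum_k p i k = 1).
Hypotheses (delta0 : 0 < delta)
  (gap : forall i u, `|u| <= delta -> u ^+ 2 / 16 <= 1 - charfun_sq (p i) (v i) u).
Hypotheses (W1 : W *m W^T = 1%:M) (rho0 : 0 < rho) (eta0 : 0 < eta)
  (Wrho : forall i, \sum_j W j i ^+ 2 <= rho ^+ 2) (eta_large : 2 * rho <= eta * delta).

Let c i := \sum_j W j i ^+ 2.
Let c_ge0 i : 0 <= c i. Proof. by apply: sumr_ge0 => j _; rewrite sqr_ge0. Qed.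

Let s (th : 'cV[R]_m) i := dotp th (col i W).

Lemma sum_sqr_dotp th : \sum_i s th i ^+ 2 = sqnorm th.
Proof.
rewrite sqnormE -[th^T]mulmx1 -W1 !mulmxA -mulmxA mxE; apply: eq_bigr => i _.
have -> : (th^T *m W) 0 i = s th i.
  by rewrite mxE; apply: eq_bigr => j _; rewrite !mxE.
have -> : (W^T *m th) i 0 = s th i.
  by rewrite mxE; apply: eq_bigr => j _; rewrite !mxE mulrC.
by rewrite expr2.
Qed.

Let q := Num.sqrt 128 : R.
Let q0 : 0 < q. Proof. by rewrite sqrtr_gt0. Qed.
Let q2 : q ^+ 2 = 128. Proof. by rewrite sqr_sqrtr. Qed.

(** The term of index (0 <= t, l), where l is the integer part of |t| / delta,
    suffices.  Its weight 2^(-l) is paid for by the factor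
    exp (- eta^2 t^2 / (2 c i)): here |t| >= l delta and c i <= rho^2, and
    eta delta >= 2 rho. *)
Lemma exp_energy_le_gauss_mixture i L (tau : bool * nat -> R) (t : R) :
  0 < c i -> (Num.truncn (`|t| / delta) < L)%N ->
  expR (- ((eta ^+ 2 * t ^+ 2 / 2 +
    (t - tau (0 <= t, Num.truncn (`|t| / delta))) ^+ 2 / 128) / c i)) <=
  \sum_(k : bool * 'I_L) 2^-1 ^+ k.2 *
     expR (- ((t - tau (k.1, nat_of_ord k.2)) / (q * Num.sqrt (c i))) ^+ 2).
Proof.
set l := Num.truncn _ => c0 lL.
rewrite (bigD1 (0 <= t, Ordinal lL)) //= mulrDl opprD expRD.
rewrite -[leLHS]addr0 lerD //; last first.
  by apply: sumr_ge0 => k _; rewrite mulr_ge0 ?expR_ge0 ?exprn_ge0.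
have -> : ((t - tau (0 <= t, l)) / (q * Num.sqrt (c i))) ^+ 2 =
   (t - tau (0 <= t, l)) ^+ 2 / 128 / c i.
  by rewrite expr_div_n exprMn q2 (sqr_sqrtr (ltW c0)) invfM mulrA.
rewrite ler_wpM2r ?expR_ge0 // expRN_nat_le //.
have /andP[] := truncn_itv (divr_ge0 (normr_ge0 t) (ltW delta0)).
rewrite -/l ler_pdivlMr // => lt _.
have l0 : 0 <= l%:R :> R := ler0n _ _.
have [l00|l1] := posnP l.
  by rewrite l00; apply: divr_ge0 (ltW c0); apply: divr_ge0 => //; apply: mulr_ge0; exact: sqr_ge0.
have {}l1 : 1 <= l%:R :> R by rewrite ler1n.
rewrite ler_pdivlMr //.
have cr : c i <= rho ^+ 2 := Wrho i.
have h1 : (l%:R * (2 * rho)) ^+ 2 <= eta ^+ 2 * t ^+ 2.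
  rewrite -(real_normK (num_real t)) -exprMn lerXn2r ?nnegrE ?mulr_ge0 ?(ltW rho0) ?(ltW eta0) //.
  apply: (@le_trans _ _ (l%:R * (eta * delta))); first by rewrite ler_wpM2l.
  by rewrite mulrCA ler_pM2l.
rewrite ler_pdivlMr //; apply: le_trans h1.
rewrite !exprMn.
apply: (@le_trans _ _ (l%:R * rho ^+ 2 * 2)); first by rewrite ler_pM2r // ler_wpM2l.
have : l%:R <= l%:R ^+ 2 :> R by nra.
by have := sqr_ge0 rho; nra.
Qed.

(** For a linearly independent family f the product over f of the mixtures of
    [exp_energy_le_gauss_mixture] expands into Gaussians in the coordinates
    <w_(f j), theta>, up to normalisation; the grid sum of each is given by
    [gauss_sum_det], and its determinant cancels [basis_volume W f].  The bound h0
    does not depend on the peaks tau or on the extent K of the grid. *)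
Lemma grid_sum_basis f : \det (colsub f W) != 0 -> exists2 h0, 0 < h0 &
  forall h K (tau : 'I_n -> bool * nat -> R), 0 < h <= h0 ->
  h ^+ m * \sum_(th <- grid (line_grid h K) m) basis_volume W f *
    expR (- \sum_j (eta ^+ 2 * s th (f j) ^+ 2 / 2 +
       (s th (f j) - tau (f j) (0 <= s th (f j), Num.truncn (`|s th (f j)| / delta))) ^+ 2
         / 128) / c (f j)) <= (32 * q) ^+ m.
Proof.
move=> d0; have cf := col_sqnorm_gt0 d0.
have cf' j : 0 < c (f j) by exact: cf.
pose r j := q * Num.sqrt (c (f j)).
have r0 j : 0 < r j by rewrite mulr_gt0 ?sqrtr_gt0.
pose U : 'M[R]_m := \matrix_(j, k) (W k (f j) / r j).
have UE : U = diag_mx (\row_j (r j)^-1) *m (colsub f W)^T.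
  by rewrite mul_diag_mx; apply/matrixP => j k; rewrite !mxE mulrC.
have dU : \det U = \det (colsub f W) / \prod_j r j.
  rewrite UE det_mulmx det_diag det_tr mulrC; congr (_ * _).
  by rewrite -prodfV; apply: eq_bigr => j _; rewrite mxE.
have pr0 : 0 < \prod_j r j by rewrite prodr_gt0.
have U0 : \det U != 0 by rewrite dU mulf_neq0 // invr_eq0 gt_eqF.
have vol : `|\det U| = basis_volume W f / q ^+ m.
  rewrite dU normrM normfV (gtr0_norm pr0) /basis_volume /r big_split /= prodr_const card_ord.
  by rewrite invfM mulrA mulrAC.
have vol0 : 0 < basis_volume W f.
  by rewrite divr_gt0 ?normr_gt0 // prodr_gt0 // => j _; rewrite sqrtr_gt0.
have [h0 h00 H] := gauss_sum_det U0; exists h0 => // h K tau hh.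
(* Large enough to index the peaks next to all the values of s on the grid. *)
pose L := (\max_(th <- grid (line_grid h K) m) \max_i Num.truncn (`|s th i| / delta)).+1.
pose tv (g : {ffun 'I_m -> bool * 'I_L}) : 'cV[R]_m :=
  \col_j (tau (f j) ((g j).1, nat_of_ord (g j).2) / r j).
pose b (k : bool * 'I_L) : R := 2^-1 ^+ k.2.
have b0 k : 0 <= b k by rewrite exprn_ge0.
have sb : \sum_k b k <= 4.
  rewrite -(pair_bigA _ (fun (_ : bool) (l : 'I_L) => (2^-1 : R) ^+ l)) /= big_bool /=.
  by have := @sum_geometric_half_le R L; lra.
apply: (@le_trans _ _ (h ^+ m * \sum_(th <- grid (line_grid h K) m) basis_volume W f *
   \sum_(g : {ffun 'I_m -> bool * 'I_L}) (\prod_j b (g j)) *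
      expR (- sqnorm (U *m th - tv g)))).
  have /andP[hp _] := hh.
  rewrite ler_wpM2l ?exprn_ge0 ?(ltW hp) // ler_sum_mem // => th thg.
  rewrite ler_wpM2l ?(ltW vol0) // -sumrN expR_sum.
  apply: (@le_trans _ _ (\prod_j \sum_(k : bool * 'I_L) b k *
     expR (- ((s th (f j) - tau (f j) (k.1, nat_of_ord k.2)) / r j) ^+ 2))).
    apply: ler_prod => j _; rewrite expR_ge0 /= exp_energy_le_gauss_mixture //.
    rewrite ltnS /L (leq_trans _ (leq_bigmax_seq _ thg _)) //.
    exact: (leq_bigmax (f j)).
  rewrite bigA_distr_bigA /= ler_sum // => g _; rewrite big_split /=.
  rewrite -expR_sum ler_wpM2l ?prodr_ge0 // ler_expR sumrN lerN2 /sqnorm.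
  rewrite le_eqVlt; apply/orP; left; apply/eqP; apply: eq_bigr => j _.
  congr (_ ^+ 2); rewrite !mxE mulrBl; congr (_ - _).
  rewrite /s /dotp mulr_suml; apply: eq_bigr => k _; rewrite !mxE; ring.
rewrite -mulr_sumr exchange_big /=.
under eq_bigr do rewrite -mulr_sumr.
rewrite mulrCA mulr_sumr.
apply: (@le_trans _ _ (basis_volume W f *
   \sum_(g : {ffun 'I_m -> bool * 'I_L}) (\prod_j b (g j)) * (8 ^+ m / `|\det U|))).
  rewrite ler_pM2l // ler_sum // => g _.
  by rewrite mulrCA ler_wpM2l ?prodr_ge0 // H.
rewrite -mulr_suml -(bigA_distr_bigA (fun=> b)) /= prodr_const card_ord vol.
have -> : basis_volume W f * ((\sum_k b k) ^+ m * (8 ^+ m / (basis_volume W f / q ^+ m))) =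
   ((\sum_k b k) * 8 * q) ^+ m.
  by rewrite !exprMn; field; rewrite !gt_eqF ?exprn_gt0.
have S0 : 0 <= \sum_k b k by rewrite sumr_ge0.
rewrite lerXn2r ?nnegrE ?mulr_ge0 ?(ltW q0) // ler_pM2r //.
by lra.
Qed.

(** W^T is an isometry, so the Gaussian factor splits into factors depending on
    the <w_i, theta>.  Together with the bumps of [charfun_peaks] they form a
    product of exp (- c i * E i), to which [weak_brascamp_lieb] applies. *)
Lemma grid_sum_charfun_sq : exists2 h0, 0 < h0 & forall h K, 0 < h <= h0 ->
  h ^+ m * \sum_(th <- grid (line_grid h K) m) expR (- (eta ^+ 2 * sqnorm th / 2)) *
     \prod_i Num.sqrt (charfun_sq (p i) (v i) (s th i))
  <= expR (m%:R / 2) * (32 * q) ^+ m.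
Proof.
have hf (f : {ffun 'I_m -> 'I_n}) : exists h0, 0 < h0 /\ (\det (colsub f W) != 0 ->
  forall h K (tau : 'I_n -> bool * nat -> R), 0 < h <= h0 ->
  h ^+ m * \sum_(th <- grid (line_grid h K) m) basis_volume W f *
    expR (- \sum_j (eta ^+ 2 * s th (f j) ^+ 2 / 2 +
       (s th (f j) - tau (f j) (0 <= s th (f j), Num.truncn (`|s th (f j)| / delta))) ^+ 2
         / 128) / c (f j)) <= (32 * q) ^+ m).
  have [d0|/grid_sum_basis[h0 ? ?]] := eqVneq (\det (colsub f W)) 0; first by exists 1.
  by exists h0.
have [H HP] := choice hf.
have [h0 h00 hle] := finite_common_lb (fun f => (HP f).1).
exists h0 => // h K /andP[hp hh0].
have [tau tauP] := choice (fun i => charfun_peaks (p0 i) (p1 i) delta0 (@gap i)).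
pose E th i := (eta ^+ 2 * s th i ^+ 2 / 2 +
   (s th i - tau i (0 <= s th i, Num.truncn (`|s th i| / delta))) ^+ 2 / 128) / c i.
apply: (@le_trans _ _ (h ^+ m * \sum_(th <- grid (line_grid h K) m)
   expR (m%:R / 2) * \sum_f basis_weight W f *
                      (basis_volume W f * expR (- \sum_j E th (f j))))).
  rewrite ler_wpM2l ?exprn_ge0 ?(ltW hp) // ler_sum // => th _.
  apply: le_trans (weak_brascamp_lieb W1 (E th)).
  rewrite -sum_sqr_dotp mulr_sumr mulr_suml -!sumrN !expR_sum -big_split /=.
  apply: ler_prod => i _; rewrite mulr_ge0 ?expR_ge0 ?sqrtr_ge0 //= -/(c i).
  (* If w_i = 0 then E i is an artefact of division by 0, but c i * E i = 0. *)
  have [ci0|ci0] := eqVneq (c i) 0.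
    rewrite ci0 mul0r oppr0 expR0; apply: mulr_ile1; rewrite ?expR_ge0 ?sqrtr_ge0 //.
      rewrite expR_le1 oppr_le0; apply: divr_ge0 => //.
      by apply: mulr_ge0; exact: sqr_ge0.
    apply: le_trans (tauP i _) _.
    by rewrite expR_le1 oppr_le0; apply: divr_ge0 => //; exact: sqr_ge0.
  by rewrite [c i * _]mulrC divfK // opprD expRD ler_wpM2l ?expR_ge0.
rewrite -mulr_sumr exchange_big /= mulrCA ler_pM2l ?expR_gt0 // mulr_sumr.
rewrite -[leRHS]mul1r -[X in _ <= X * _](basis_weight_sum1 W1) mulr_suml ler_sum // => f _.
rewrite -mulr_sumr mulrCA.
have [d0|d0] := eqVneq (\det (colsub f W)) 0.
  by rewrite /basis_weight d0 expr0n /= !mul0r.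
rewrite ler_wpM2l ?basis_weight_ge0 //; apply: ((HP f).2 d0 h K tau).
by rewrite hp (le_trans hh0).
Qed.

(** The window of [cos_kernel_lower] is nonnegative, and at least e^(-2m) on the
    ball.  Its expectation expands into characters ([sum_grid_cos]), which
    independence bounds by products of moduli ([expect_cos_le]); the binomial
    weights are bounded by Gaussian ones, and [grid_sum_charfun_sq] concludes. *)
Lemma small_ball_isotropic (z : 'cV[R]_m) :
  \sum_(x : {ffun 'I_n -> I} |
      sqnorm (\sum_i v i (x i) *: col i W - z) <= 4 * eta ^+ 2 * m%:R) \prod_i p i (x i)
  <= (expR (5 / 2) * 32 * q * eta) ^+ m.
Proof.
have [h0 h00 H] := grid_sum_charfun_sq.
(* K >= m serves the lower bound on the window; the other term makes
   h = 1 / (eta sqrt K) at most h0. *)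
pose K := (m + (Num.truncn ((eta * h0) ^- 2)).+1)%N.
have Kp : (0 < K)%N by rewrite /K addnS.
have K0 : 0 < K%:R :> R by rewrite ltr0n.
have sK0 : 0 < Num.sqrt K%:R :> R by rewrite sqrtr_gt0.
pose h := (eta * Num.sqrt K%:R)^-1.
have hp : 0 < h by rewrite invr_gt0 mulr_gt0.
have KE : K%:R * (h * eta) ^+ 2 = 1.
  rewrite /h invfM mulrAC mulVf ?gt_eqF // mul1r exprVn sqr_sqrtr ?(ltW K0) //.
  by rewrite mulfV // gt_eqF.
have hh : 0 < h <= h0.
  rewrite hp /=; have eh : 0 < eta * h0 by rewrite mulr_gt0.
  have Kl : (eta * h0) ^- 2 <= K%:R.
    apply: le_trans (ltW (truncnS_gt _)) _; rewrite ler_nat /K; exact: leq_addl.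
  rewrite -(@ler_pXn2r _ 2) ?nnegrE ?(ltW hp) ?(ltW h00) //.
  have -> : h ^+ 2 = (eta ^+ 2 * K%:R)^-1.
    by rewrite /h exprVn exprMn sqr_sqrtr ?(ltW K0).
  rewrite invf_ple ?posrE ?exprn_gt0 ?mulr_gt0 ?exprn_gt0 //.
  move: Kl; rewrite exprMn invfM ler_pdivrMl ?exprn_gt0 //.
pose X (x : {ffun 'I_n -> I}) := \sum_i v i (x i) *: col i W - z.
pose ker (x : {ffun 'I_n -> I}) := \prod_j cos (h * X x j 0 / 2) ^+ K.*2.
have pp (x : {ffun 'I_n -> I}) : 0 <= \prod_i p i (x i) by rewrite prodr_ge0.
have ker0 x : 0 <= ker x.
  by apply: prodr_ge0 => j _; rewrite exprn_even_ge0 // odd_double.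
apply: (@le_trans _ _ (expR (2 * m%:R) *
  \sum_(x : {ffun 'I_n -> I}) (\prod_i p i (x i)) * ker x)).
  rewrite mulr_sumr big_mkcond /= ler_sum // => x _; case: ifP => [xz|_]; last first.
    by rewrite mulr_ge0 ?expR_ge0 // mulr_ge0.
  rewrite mulrCA -[leLHS]mulr1 ler_wpM2l //.
  rewrite -[leLHS](@expRxMexpNx_1 _ (2 * m%:R)) ler_wpM2l ?expR_ge0 //.
  by apply: (cos_kernel_lower hp eta0 KE) => //; rewrite /K leq_addr.
have -> : \sum_(x : {ffun 'I_n -> I}) (\prod_i p i (x i)) * ker x =
   \sum_(th <- grid (line_grid h K) m) (\prod_j binomial_weight h K (th j 0)) *
     \sum_(x : {ffun 'I_n -> I}) (\prod_i p i (x i)) *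
       cos (\sum_i s th i * v i (x i) + - dotp th z).
  under [RHS]eq_bigr do rewrite mulr_sumr.
  rewrite exchange_big; apply: eq_bigr => x _ /=.
  have := sum_grid_cos K 0 (X x) hp; rewrite cos0 mul1r /ker => <-.
  rewrite mulr_sumr; apply: eq_bigr => th _.
  rewrite add0r mulrCA; congr (_ * (_ * cos _)).
  transitivity (dotp th (\sum_i v i (x i) *: col i W) - dotp th z).
    by rewrite /X /dotp -sumrB; apply: eq_bigr => j _; rewrite mxE [(- z) j 0]mxE mulrBr.
  congr (_ - _); transitivity (\sum_j \sum_i th j 0 * (v i (x i) * W j i)).
    apply: eq_bigr => j _; rewrite summxE mulr_sumr.
    by apply: eq_bigr => i _; rewrite !mxE.
  rewrite exchange_big; apply: eq_bigr => i _ /=.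
  rewrite /s /dotp mulr_suml; apply: eq_bigr => j _; rewrite !mxE; ring.
have -> : (expR (5 / 2) * 32 * q * eta) ^+ m =
   expR (2 * m%:R) * (eta ^+ m * (expR (m%:R / 2) * (32 * q) ^+ m)).
  have -> : expR (2 * m%:R) = expR 2 ^+ m :> R by rewrite mulrC expRM_natl.
  have -> : expR (m%:R / 2) = expR (1 / 2) ^+ m :> R.
    by rewrite -expRM_natl mulrA mulr1.
  rewrite !exprMn mulrA [_ * eta ^+ m]mulrC; have -> : 5 / 2 = 2 + 1 / 2 :> R by field.
  by rewrite expRD exprMn; ring.
rewrite ler_pM2l ?expR_gt0 //.
apply: le_trans (ler_wpM2l (exprn_ge0 m (ltW eta0)) (H h K hh)).
rewrite mulrA mulr_sumr ler_sum_mem // => th thg.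
apply: (@le_trans _ _ ((\prod_j binomial_weight h K (th j 0)) *
    \prod_i Num.sqrt (charfun_sq (p i) (v i) (s th i)))).
  rewrite ler_wpM2l ?expect_cos_le // prodr_ge0 // => j _; exact: binomial_weight_ge0.
rewrite [leRHS]mulrA ler_wpM2r //; first by rewrite prodr_ge0 // => i _; exact: sqrtr_ge0.
by rewrite -mulrA; exact: prod_binomial_weight_le.
Qed.
End Discrete.

(** * Whitening, and spread of a truncated variable *)

(** B is the inverse of a Cholesky factor of A.  It is a contraction because
    y = A^(-1) x satisfies |B x|^2 = <x, y> = y^T A y >= |y|^2, so that
    0 <= |x - y|^2 <= |x|^2 - |B x|^2. *)
Lemma whitening (R : realType) (m : nat) (A : 'M[R]_m) : loewner_ge A 1%:M ->
  exists2 B : 'M[R]_m, B *m A *m B^T = 1%:M &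
    forall x : 'cV[R]_m, sqnorm (B *m x) <= sqnorm x.
Proof.
move=> [sA pA].
have sA' : A^T = A.
  by move: sA; rewrite raddfB /= trmx1 => /addIr.
have A1 x : sqnorm x <= (x^T *m A *m x) 0 0.
  have := pA x; rewrite mulmxBr mulmxBl mulmx1 sqnormE mxE [X in _ + X]mxE.
  by rewrite subr_ge0.
have [//|x x0|L [tL pL LE]] := @cholesky R m A.
  apply: lt_le_trans (A1 x); rewrite lt_neqAle sqnorm_ge0 andbT eq_sym.
  by apply: contraNneq x0 => /sqnorm_eq0 ->.
have Lu : L \in unitmx.
  by rewrite unitmxE unitfE det_trig // gt_eqF // prodr_gt0.
exists (invmx L) => [|x].
  by rewrite -LE mulmxA mulVmx // mul1mx trmx_inv mulmxV ?unitmx_tr.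
(* y is the solution of A y = x. *)
pose y := (invmx L)^T *m (invmx L *m x).
have Ay : A *m y = x.
  rewrite /y -LE trmx_inv -[L *m L^T *m _]mulmxA mulKVmx ?unitmx_tr //.
  by rewrite mulKVmx.
have Qxy : (x^T *m y) 0 0 = sqnorm (invmx L *m x).
  by rewrite /y sqnormE trmx_mul !mulmxA.
have Qyy : (y^T *m A *m y) 0 0 = sqnorm (invmx L *m x).
  by rewrite -mulmxA Ay -Qxy -[y^T *m x]trmxK trmx_mul trmxK mxE.
have yQ := A1 y; rewrite Qyy in yQ.
have dxy : sqnorm (x - y) = sqnorm x - 2 * (x^T *m y) 0 0 + sqnorm y.
  rewrite mxE mulr_sumr /sqnorm -sumrB -big_split /=.
  by apply: eq_bigr => j _; rewrite !mxE; ring.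
have := sqnorm_ge0 (x - y); rewrite dxy Qxy; lra.
Qed.

(** Whitening shrinks distances, so it can only enlarge the event. *)
Lemma small_ball_discrete (R : realType) (I : finType) (n m : nat)
    (p v : 'I_n -> I -> R) (w : 'I_n -> 'cV[R]_m) (delta rho eta : R) :
  (forall i k, 0 <= p i k) -> (forall i, \sum_k p i k = 1) -> 0 < delta ->
  (forall i u, `|u| <= delta -> u ^+ 2 / 16 <= 1 - charfun_sq (p i) (v i) u) ->
  loewner_ge (\sum_i w i *m (w i)^T) 1%:M ->
  0 < rho -> (forall i, sqnorm (w i) <= rho ^+ 2) -> 0 < eta ->
  2 * rho <= eta * delta ->
  forall z : 'cV[R]_m,
  \sum_(x : {ffun 'I_n -> I} |
      sqnorm (\sum_i v i (x i) *: w i - z) <= 4 * eta ^+ 2 * m%:R) \prod_i p i (x i)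
  <= (expR (5 / 2) * 32 * Num.sqrt 128 * eta) ^+ m.
Proof.
move=> p0 p1 delta0 gap wI rho0 wrho eta0 large z.
have [B BAB Bcontr] := whitening wI.
pose W : 'M[R]_(m, n) := B *m \matrix_(j, i) w i j 0.
have colW i : col i W = B *m w i.
  rewrite /W colE -mulmxA -colE; congr (_ *m _); apply/colP => j; by rewrite !mxE.
have W1 : W *m W^T = 1%:M.
  rewrite -BAB /W trmx_mul !mulmxA; congr (_ *m _); rewrite -!mulmxA; congr (_ *m _).
  apply/matrixP => j k; rewrite mxE summxE; apply: eq_bigr => i _.
  by rewrite !mxE big_ord1 !mxE.
have Wrho i : \sum_j W j i ^+ 2 <= rho ^+ 2.
  apply: le_trans (wrho i); apply: le_trans (Bcontr (w i)); rewrite -colW /sqnorm.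
  by under [leRHS]eq_bigr do rewrite mxE.
apply: le_trans (small_ball_isotropic p0 p1 delta0 gap W1 rho0 eta0 Wrho large (B *m z)).
rewrite big_mkcond [leRHS]big_mkcond /= ler_sum // => x _.
have le : sqnorm (\sum_i v i (x i) *: col i W - B *m z) <=
    sqnorm (\sum_i v i (x i) *: w i - z).
  apply: le_trans (Bcontr _); rewrite mulmxBr mulmx_sumr.
  have -> // : \sum_i v i (x i) *: col i W = \sum_i B *m (v i (x i) *: w i).
  by apply: eq_bigr => i _; rewrite colW scalemxAr.
case: ifP => [/(le_trans le) -> //|_]; case: ifP => // _.
by rewrite prodr_ge0.
Qed.

Section Gap.
Variables (R : realType) (I : finType) (p v : I -> R) (M : R).
Hypotheses (M0 : 0 < M) (p0 : forall k, 0 <= p k) (p1 : \sum_k p k = 1).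
Hypotheses (mean : `|\sum_k v k * p k| <= 16^-1)
  (var : \sum_k v k ^+ 2 * p k <= 3)
  (trunc : 7 / 16 <= \sum_k (v k ^+ 2 * (`|v k| <= M)%R%:R) * p k).

Let M' := M + 12.
Let g k : R := (`|v k| <= M')%R%:R.
Let M'12 : 12 <= M'. Proof. by rewrite /M' lerDr ltW. Qed.
Let M'0 : 0 < M'. Proof. exact: lt_le_trans M'12. Qed.

Lemma pair_variance (a : I -> R) :
  \sum_k \sum_l a k * a l * (v k - v l) ^+ 2 =
  2 * ((\sum_k v k ^+ 2 * a k) * (\sum_k a k) - (\sum_k v k * a k) ^+ 2).
Proof.
transitivity (\sum_k \sum_l ((v k ^+ 2 * a k) * a l + a k * (v l ^+ 2 * a l)
   - 2 * ((v k * a k) * (v l * a l)))).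
  by apply: eq_bigr => k _; apply: eq_bigr => l _; ring.
under eq_bigr do rewrite sumrB big_split /= -!mulr_sumr.
by rewrite sumrB big_split /= -mulr_sumr -!mulr_suml expr2; ring.
Qed.

(** By Chebyshev and Markov, the values beyond M + 12 carry little mass and
    contribute little to the mean, which is nearly 0: so the truncated mean is
    small, while the truncated second moment is not. *)
Lemma trunc_pair_variance : 4^-1 <=
  (\sum_k v k ^+ 2 * (p k * g k)) * (\sum_k p k * g k) - (\sum_k v k * (p k * g k)) ^+ 2.
Proof.
have g01 k : 0 <= g k <= 1 by rewrite /g ler0n lern1; case: (_ <= _).
have S : 7 / 16 <= \sum_k v k ^+ 2 * (p k * g k).
  apply: le_trans trunc _; apply: ler_sum => k _.
  rewrite -mulrA [_%:R * p k]mulrC; rewrite !mulrA ler_wpM2l ?(mulr_ge0 (sqr_ge0 _) (p0 k)) //.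
  rewrite /g ler_nat; case: (lerP `|v k| M) => //= vM.
  by rewrite (le_trans vM) // /M'; lra.
have Q : 47 / 48 <= \sum_k p k * g k.
  rewrite -lerN2 -(lerD2l (\sum_k p k)) -sumrB p1.
  apply: (@le_trans _ _ (\sum_k v k ^+ 2 * p k / 144)); last first.
    by rewrite -mulr_suml; have := var; lra.
  apply: ler_sum => k _; have := p0 k; rewrite /g; case: (lerP `|v k| M') => /= [_|vM] pk.
    by rewrite mulr1 subrr mulr_ge0 // mulr_ge0 ?sqr_ge0.
  rewrite mulr0 subr0 mulrAC ler_peMl // ler_pdivlMr // mul1r.
  rewrite -(real_normK (num_real (v k))).
  have : 12 <= `|v k| by exact: le_trans (ltW vM).
  by move=> ?; nra.
have Q1 : \sum_k p k * g k <= 1.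
  by rewrite -p1 ler_sum // => k _; have /andP[_ ?] := g01 k; rewrite ler_piMr.
have U : `|\sum_k v k * (p k * g k)| <= 5 / 16.
  have -> : \sum_k v k * (p k * g k) =
      \sum_k v k * p k - \sum_k v k * (p k * (1 - g k)).
    by rewrite -sumrB; apply: eq_bigr => k _; ring.
  apply: le_trans (ler_normB _ _) _.
  have -> : 5 / 16 = 16^-1 + 4^-1 :> R by field.
  rewrite lerD //; apply: le_trans (ler_norm_sum _ _ _) _.
  apply: (@le_trans _ _ (\sum_k v k ^+ 2 * p k / 12)); last first.
    by rewrite -mulr_suml; have := var; lra.
  apply: ler_sum => k _; have := p0 k; rewrite /g; case: (lerP `|v k| M') => /= [_|vM] pk.
    by rewrite subrr !mulr0 normr0 mulr_ge0 // mulr_ge0 ?sqr_ge0.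
  rewrite subr0 mulr1 normrM (ger0_norm pk) mulrAC ler_wpM2r // ler_pdivlMr //.
  rewrite -(real_normK (num_real (v k))) expr2 ler_wpM2l //.
  exact: le_trans (ltW vM).
have U2 : (\sum_k v k * (p k * g k)) ^+ 2 <= 25 / 256.
  rewrite -(real_normK (num_real _)).
  have := normr_ge0 (\sum_k v k * (p k * g k)); nra.
nra.
Qed.

(** On pairs of values at distance at most 2 (M + 12) the argument of the cosine is
    at most 2, so that 1 - cos is bounded below by a multiple of its square. *)
Lemma charfun_sq_gap u : `|u| <= M'^-1 -> u ^+ 2 / 16 <= 1 - charfun_sq p v u.
Proof.
move=> uM; rewrite one_sub_charfun_sq //.
apply: (@le_trans _ _ (\sum_k \sum_l (p k * g k) * (p l * g l) * (v k - v l) ^+ 2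
     * (u ^+ 2 / 8))).
  under eq_bigr do rewrite -mulr_suml.
  rewrite -mulr_suml pair_variance; have := trunc_pair_variance.
  have := sqr_ge0 u; nra.
apply: ler_sum => k _; apply: ler_sum => l _.
have c1 := cos_le1 (u * (v k - v l)).
have rhs0 : 0 <= p k * p l * (1 - cos (u * (v k - v l))).
  by rewrite mulr_ge0 ?mulr_ge0 // subr_ge0.
rewrite /g; case: (lerP `|v k| M') => [vk|_] /=; last by rewrite mulr0 !mul0r.
case: (lerP `|v l| M') => [vl|_] /=; last by rewrite !mulr0 !mul0r.
rewrite !mulr1 -mulrA ler_wpM2l ?mulr_ge0 //.
have -> : (v k - v l) ^+ 2 * (u ^+ 2 / 8) = (u * (v k - v l)) ^+ 2 / 8 by field.
apply: cos_le_quadratic; rewrite normrM.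
apply: (@le_trans _ _ (M'^-1 * (2 * M'))); last by rewrite mulrCA mulVf ?mulr1 // gt_eqF.
apply: ler_pM => //; apply: le_trans (ler_normB _ _) _; lra.
Qed.
End Gap.

(** * Rounding a random variable to finitely many values *)

Section Quantizer.
Variables (R : realType) (h : R) (N : nat).
Hypothesis h0 : 0 < h.

Definition cell_left (l : nat) : R := (l%:R - N%:R) * h.

(** Rounds x down to a multiple of h; None stands for an x outside
    [- N h, N h). *)
Definition quantize (x : R) : option 'I_N.*2 :=
  [pick l : 'I_N.*2 | cell_left l <= x < cell_left l + h].

Definition cell_value (k : option 'I_N.*2) : R :=
  if k is Some l then cell_left l else 0.

Lemma cell_uniq x (l l' : nat) : cell_left l <= x < cell_left l + h ->
  cell_left l' <= x < cell_left l' + h -> l = l'.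
Proof.
have step (a b : nat) : (a < b)%N -> cell_left a + h <= cell_left b.
  move=> ab; rewrite /cell_left -{2}[h]mul1r -mulrDl ler_pM2r //.
  by rewrite addrAC lerD2r natr1 ler_nat.
move=> /andP[l1 l2] /andP[l3 l4].
case: (ltngtP l l') => // /step ll'; exfalso.
  by have := lt_le_trans l2 ll'; lra.
by have := lt_le_trans l4 ll'; lra.
Qed.

Lemma quantize_some l :
  quantize @^-1` [set Some l] = `[cell_left l, cell_left l + h[%classic.
Proof.
apply/seteqP; split => x /=; rewrite in_itv /quantize /=.
  by case: pickP => // l' xl' [<-].
move=> xl; case: pickP => [l' xl'|/(_ l)]; last by rewrite xl.
by congr Some; apply/val_inj/(cell_uniq xl' xl).
Qed.

Lemma quantize_none :
  quantize @^-1` [set None] = ~` `[- (N%:R * h), N%:R * h[%classic.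
Proof.
apply/seteqP; split => x /=; rewrite in_itv /quantize /=.
  case: pickP => // no _ /andP[x1 x2].
  have x0 : 0 <= x / h + N%:R.
    by rewrite -lerBlDr sub0r ler_pdivlMr // mulNr.
  have /andP[t1 t2] := truncn_itv x0; set l := Num.truncn _ in t1 t2.
  have lN : (l < N.*2)%N.
    rewrite -(ltr_nat R); apply: le_lt_trans t1 _.
    by rewrite -addnn natrD ltrD2r ltr_pdivrMr.
  have := no (Ordinal lN); rewrite /cell_left /= => /negP; apply; apply/andP; split.
    by rewrite -ler_pdivlMr // lerBlDr.
  rewrite -{2}[h]mul1r -mulrDl -ltr_pdivrMr // -ltrBlDr; move: t2; rewrite -natr1; lra.
case: pickP => // l /= /andP[l1 l2] nx; exfalso; apply: nx; apply/andP; split.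
  apply: le_trans l1; rewrite /cell_left -mulNr ler_pM2r //.
  by rewrite lerDr.
apply: lt_le_trans l2 _; rewrite /cell_left -{2}[h]mul1r -mulrDl ler_pM2r //.
rewrite addrAC lerBlDr -natrD addnn natr1 ler_nat; exact: ltn_ord.
Qed.

Lemma measurable_quantize k : measurable (quantize @^-1` [set k]).
Proof.
case: k => [l|]; first by rewrite quantize_some; exact: measurable_itv.
by rewrite quantize_none; apply: measurableC; exact: measurable_itv.
Qed.

Lemma cell_valueP x l : quantize x = Some l -> 0 <= x - cell_value (Some l) <= h.
Proof.
rewrite /quantize; case: pickP => // l' /andP[l1 l2] [<-] /=.
by rewrite subr_ge0 l1 /= lerBlDl ltW.
Qed.

Lemma quantize_noneP x : quantize x = None -> N%:R * h <= `|x|.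
Proof.
move=> qx; have : (quantize @^-1` [set None]) x by [].
rewrite quantize_none /= in_itv /= => /negP; rewrite negb_and -ltNge -leNgt.
by case/orP => [xl|xl]; rewrite ler_normr; apply/orP; [right|left => //]; lra.
Qed.

End Quantizer.

Section Moments.
Context d (T : measurableType d) (R : realType) (P : probability T R).
Variables (X : {RV P >-> R}) (M : R).
Hypotheses (EX : ('E_P[X] = 0)%E) (VX : ('V_P[X] = 1)%E)
  (TX : ((2^-1)%:E <= 'E_P[fun t => (X t ^+ 2 * \1_[set s | `|X s| <= M] t)%R])%E).

Let Int (f : T -> R) := P.-integrable setT (EFin \o f).
Let trunc (t : T) : R := X t ^+ 2 * \1_[set s | `|X s| <= M] t.

Lemma measurable_RV_norm_le : measurable [set s | `|X s| <= M].
Proof.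
have -> : [set s | `|X s| <= M] = (fun s => `|X s|) @^-1` `]-oo, M].
  by apply/seteqP; split => x /=; rewrite in_itv.
rewrite -[Y in measurable Y]setTI.
by apply: measurableT_comp => //; exact: measurable_itv.
Qed.

Lemma measurable_RV : measurable_fun setT X.
Proof. exact: measurable_funP. Qed.

Lemma expectation_sqr : (\int[P]_t (X t ^+ 2)%:E = 1)%E.
Proof.
rewrite -VX /variance covariance.unlock EX expectation.unlock; apply: eq_integral => t _.
by rewrite fctE /= subr0 expr2.
Qed.

Lemma integrable_sqr : Int (fun t => X t ^+ 2).
Proof.
apply/integrableP; split.
  by apply/measurable_EFinP; apply: measurable_funX; exact: measurable_RV.
under eq_integral do rewrite /= ger0_norm ?sqr_ge0 //.
by rewrite expectation_sqr ltry.
Qed.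

Lemma integrable_const (a : R) : Int (fun=> a).
Proof. exact: finite_measure_integrable_cst. Qed.

Lemma integrable_add f g : Int f -> Int g -> Int (fun t => f t + g t).
Proof. exact: integrableD. Qed.

Lemma integrable_scale a f : Int f -> Int (fun t => a * f t).
Proof. exact: integrableZl. Qed.

Lemma integrable_RV : Int X.
Proof.
apply: (le_integrable measurableT _ _ (integrable_add (integrable_const 1) integrable_sqr)).
  by apply/measurable_EFinP; exact: measurable_RV.
move=> t _ /=; rewrite lee_fin [leRHS]ger0_norm; last by rewrite addr_ge0 ?sqr_ge0.
by rewrite -(real_normK (num_real (X t))); have := sqr_ge0 (`|X t| - 2^-1); nra.
Qed.

Lemma integrable_trunc : Int trunc.
Proof.
apply: (le_integrable measurableT _ _ integrable_sqr).
  apply/measurable_EFinP; apply: measurable_funM.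
    by apply: measurable_funX; exact: measurable_RV.
  exact/measurable_indic/measurable_RV_norm_le.
move=> t _ /=; rewrite lee_fin /trunc normrM ler_piMr // indicE.
by case: (_ \in _); rewrite ?normr1 ?normr0.
Qed.

Lemma Rintegral_sqr : \int[P]_t (X t ^+ 2) = 1.
Proof. by rewrite /Rintegral expectation_sqr. Qed.

Lemma Rintegral_RV : \int[P]_t X t = 0.
Proof. by rewrite /Rintegral -expectation_def EX. Qed.

Lemma Rintegral_trunc : 2^-1 <= \int[P]_t trunc t.
Proof.
move: TX; rewrite expectation.unlock -lee_fin /Rintegral fineK //.
exact: (integrable_fin_num measurableT integrable_trunc).
Qed.

Lemma Rintegral_simple (I : finType) (g : R -> I) (F : I -> R) :
  (forall k, measurable (g @^-1` [set k])) ->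
  Int (fun t => F (g (X t))) /\
  \int[P]_t F (g (X t)) = \sum_k F k * fine (P (X @^-1` (g @^-1` [set k]))).
Proof.
move=> mg; pose A k := X @^-1` (g @^-1` [set k]).
have mA k : measurable (A k) by exact: measurable_funPTI.
have IA k : Int (\1_(A k)) by exact: integrable_indic.
have FE t : F (g (X t)) = \sum_k F k * \1_(A k) t.
  rewrite (bigD1 (g (X t))) //= indicE mem_set // mulr1 big1 ?addr0 // => k kg.
  by rewrite indicE memNset ?mulr0 // => /= gk; rewrite -gk eqxx in kg.
have main (r : seq I) : Int (fun t => \sum_(k <- r) F k * \1_(A k) t) /\
    \int[P]_t (\sum_(k <- r) F k * \1_(A k) t) = \sum_(k <- r) F k * fine (P (A k)).
  elim: r => [|k r [Ir Er]].
    under eq_fun do rewrite big_nil; split; first exact: integrable_const.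
    by rewrite Rintegral_cst // mul0r big_nil.
  under eq_fun do rewrite big_cons; split.
    by apply: integrable_add => //; exact: integrable_scale.
  rewrite RintegralD //; last exact: integrable_scale.
  rewrite Er big_cons RintegralZl //; last exact: IA.
  congr (_ * _ + _).
  by rewrite /Rintegral integral_indic // setIT.
have [I1 I2] := main (index_enum I); split.
  by under eq_fun do rewrite FE.
by rewrite -I2; apply: eq_Rintegral => t _; rewrite FE.
Qed.

(** Integrates a pointwise inequality between a function of the rounded variable
    and a combination of 1, X, X^2 and the truncated square, whose expectations
    are 1, 0, 1 and at least 1/2.  All the moments of the rounded variable are
    controlled through it. *)
Lemma moment_bound (I : finType) (g : R -> I) (F : I -> R) (c0 c1 c2 c3 : R) :
  (forall k, measurable (g @^-1` [set k])) -> 0 <= c3 ->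
  (forall x, c0 + c1 * x + c2 * x ^+ 2 + c3 * (x ^+ 2 * (`|x| <= M)%R%:R) <= F (g x)) ->
  c0 + c2 + c3 / 2 <= \sum_k F k * fine (P (X @^-1` (g @^-1` [set k]))).
Proof.
move=> mg c30 H; have [IF <-] := Rintegral_simple F mg.
have I0 := integrable_const c0; have I1 := integrable_scale c1 integrable_RV.
have I2 := integrable_scale c2 integrable_sqr.
have I3 := integrable_scale c3 integrable_trunc.
have I01 := integrable_add I0 I1; have I012 := integrable_add I01 I2.
have I0123 := integrable_add I012 I3.
apply: (@le_trans _ _ (\int[P]_t (c0 + c1 * X t + c2 * X t ^+ 2 + c3 * trunc t))).
  rewrite !RintegralD // !RintegralZl //; last 3 first.
  - exact: integrable_trunc.
  - exact: integrable_sqr.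
  - exact: integrable_RV.
  rewrite Rintegral_cst // Rintegral_RV Rintegral_sqr; set q := fine _.
  have -> : q = 1 by apply: (congr1 fine (y := 1%E)); exact: probability_setT.
  by have := Rintegral_trunc; nra.
apply: le_Rintegral => // t _; apply: le_trans (H (X t)).
rewrite lerD2l /trunc indicE; have [tM|tM] := boolP (`|X t| <= M).
  by rewrite mem_set.
by rewrite memNset //; exact/negP.
Qed.
End Moments.

(** * Moments and independence of the rounded variables *)

Section QuantizedMoments.
Context d (T : measurableType d) (R : realType) (P : probability T R).
Variables (X : {RV P >-> R}) (M h : R) (N : nat).
Hypotheses (EX : ('E_P[X] = 0)%E) (VX : ('V_P[X] = 1)%E)
  (TX : ((2^-1)%:E <= 'E_P[fun t => (X t ^+ 2 * \1_[set s | `|X s| <= M] t)%R])%E).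
Hypotheses (M0 : 0 < M) (h0 : 0 < h) (h32 : h <= 32^-1) (hM : h * M <= 32^-1)
  (A32 : M + 32 <= N%:R * h).

Definition quantized_prob (k : option 'I_N.*2) : R :=
  fine (P (X @^-1` (quantize h N @^-1` [set k]))).

Lemma quantized_prob_ge0 k : 0 <= quantized_prob k.
Proof. by rewrite fine_ge0. Qed.

Let A := N%:R * h.

Let A0 : 0 < A. Proof. by apply: lt_le_trans A32; rewrite addr_gt0. Qed.

Let bound (F : option 'I_N.*2 -> R) c0 c1 c2 c3 :=
  moment_bound (F := F) (c0 := c0) (c1 := c1) (c2 := c2) (c3 := c3) EX VX TX
    (@measurable_quantize R h N h0).

Lemma quantized_prob_sum1 : \sum_k quantized_prob k = 1.
Proof.
apply/eqP; rewrite eq_le; apply/andP; split.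
  have := @bound (fun=> -1) (-1) 0 0 0 (lexx _).
  under eq_bigr do rewrite mulN1r.
  rewrite sumrN mul0r !addr0 lerN2; apply.
  by move=> x; rewrite !mul0r !addr0.
have := @bound (fun=> 1) 1 0 0 0 (lexx _).
under eq_bigr do rewrite mul1r.
rewrite mul0r !addr0; apply.
by move=> x; rewrite !mul0r !addr0.
Qed.

Lemma quantized_prob_none : quantized_prob None <= (A ^+ 2)^-1.
Proof.
have := @bound (fun k => - (k == None)%:R) 0 0 (- (A ^+ 2)^-1) 0 (lexx _).
rewrite mul0r addr0 add0r (bigD1 None) //= mulN1r big1 ?addr0 => [|k /negPf ->]; last first.
  by rewrite oppr0 mul0r.
rewrite lerN2; apply => x.
rewrite !mul0r !add0r addr0 mulNr lerN2.
have [qx|_] := eqVneq (quantize h N x) None; last first.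
  by rewrite mulr_ge0 ?sqr_ge0 // invr_ge0 sqr_ge0.
rewrite -(real_normK (num_real x)) mulrC ler_pdivlMr ?exprn_gt0 // mul1r.
have := quantize_noneP h0 qx; rewrite -/A => Ax.
by rewrite ler_pXn2r ?nnegrE // ltW.
Qed.

Lemma quantizeP x :
  (0 <= x - cell_value h (quantize h N x) <= h) \/
  (cell_value h (quantize h N x) = 0 /\ A <= `|x|).
Proof.
case qx : (quantize h N x) => [l|].
  by left; exact: (cell_valueP qx).
by right; split => //; exact: quantize_noneP.
Qed.

Lemma norm_le_sqr_div x : A <= `|x| -> `|x| <= x ^+ 2 / A.
Proof.
by move=> Ax; rewrite ler_pdivlMr // -(real_normK (num_real x)) expr2 ler_wpM2l.
Qed.

(** The rounding error is at most h inside the range and at most x^2 / A outside it,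
    where A = N h. *)
Lemma quantized_mean : `|\sum_k cell_value h k * quantized_prob k| <= 16^-1.
Proof.
have A32' : A^-1 <= 32^-1.
  by rewrite lef_pV2 ?posrE //; apply: le_trans A32; have := M0; lra.
have Ai0 : 0 < A^-1 by rewrite invr_gt0.
have h16 := h32.
have L : - h - A^-1 <= \sum_k cell_value h k * quantized_prob k.
  have := @bound (cell_value h (N:=N)) (- h) 1 (- A^-1) 0 (lexx _).
  rewrite mul0r addr0; apply => x; rewrite mul1r mul0r addr0 mulNr.
  have := sqr_ge0 x => x2.
  have [/andP[v1 v2]|[-> /norm_le_sqr_div]] := quantizeP x.
    by have : 0 <= A^-1 * x ^+ 2 by [rewrite mulr_ge0 // ltW]; lra.
  by rewrite mulrC => Ax; have := ler_norm x; have := h0; lra.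
have U : - A^-1 <= - \sum_k cell_value h k * quantized_prob k.
  have := @bound (fun k => - cell_value h k) 0 (-1) (- A^-1) 0 (lexx _).
  under eq_bigr do rewrite mulNr.
  rewrite sumrN mul0r addr0 add0r; apply => x; rewrite mulN1r mul0r addr0 add0r mulNr.
  have := sqr_ge0 x => x2.
  have [/andP[v1 v2]|[-> /norm_le_sqr_div]] := quantizeP x.
    by have : 0 <= A^-1 * x ^+ 2 by [rewrite mulr_ge0 // ltW]; lra.
  by rewrite mulrC => Ax; have := ler_norm (- x); rewrite normrN; lra.
by rewrite ler_norml; lra.
Qed.

Lemma quantized_second_moment : \sum_k cell_value h k ^+ 2 * quantized_prob k <= 3.
Proof.
have hh := h0; have h16 := h32.
have := @bound (fun k => - cell_value h k ^+ 2) (- (2 * h ^+ 2)) 0 (-2) 0 (lexx _).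
under eq_bigr do rewrite mulNr.
rewrite sumrN => B.
have : - (2 * h ^+ 2) + - 2 + 0 / 2 <= - \sum_k cell_value h k ^+ 2 * quantized_prob k.
  apply: B => x; rewrite !mul0r !addr0.
  have := sqr_ge0 x => x2; have h2 := sqr_ge0 h.
  have [/andP[v1 v2]|[-> _]] := quantizeP x; last by rewrite expr0n oppr0; lra.
  set v := cell_value _ _ in v1 v2 *.
  by have := sqr_ge0 (2 * x - v); have := sqr_ge0 (x + (x - v)); nra.
by nra.
Qed.

Lemma quantized_trunc_moment : 7 / 16 <=
  \sum_k (cell_value h k ^+ 2 * (`|cell_value h k| <= M + 1)%R%:R) * quantized_prob k.
Proof.
have hh := h0; have h16 := h32; have hM' := hM; have M0' := M0.
have := @bound (fun k => cell_value h k ^+ 2 * (`|cell_value h k| <= M + 1)%R%:R)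
   (- (2 * (h * M))) 0 0 1 ler01.
rewrite addr0 => B.
have {}B := B _; apply: (le_trans _ (B _)); first by lra.
move=> x; rewrite !mul0r !addr0 mul1r.
have F0 y : 0 <= y ^+ 2 * (`|y| <= M + 1)%R%:R :> R by rewrite mulr_ge0 ?sqr_ge0.
have [xM|xM] := lerP `|x| M; last first.
  rewrite mulr0 addr0; apply: le_trans (F0 _).
  by rewrite oppr_le0 !mulr_ge0 // ltW.
rewrite mulr1.
have [/andP[v1 v2]|[_ Ax]] := quantizeP x; last first.
  by have := A32; rewrite -/A; lra.
set v := cell_value _ _ in v1 v2 *.
have vM : `|v| <= M + 1.
  have -> : v = x - (x - v) by ring.
  apply: le_trans (ler_normB _ _) _; rewrite (ger0_norm v1); lra.
rewrite vM mulr1.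
have xx : `|x * (x - v)| <= M * h by rewrite normrM (ger0_norm v1) ler_pM.
have := ler_norm (x * (x - v)); have := sqr_ge0 (x - v); nra.
Qed.

Lemma quantized_gap u : `|u| <= (M + 13)^-1 ->
  u ^+ 2 / 16 <= 1 - charfun_sq quantized_prob (cell_value h (N:=N)) u.
Proof.
have -> : M + 13 = M + 1 + 12 by ring.
apply: charfun_sq_gap.
- by have := M0; lra.
- exact: quantized_prob_ge0.
- exact: quantized_prob_sum1.
- exact: quantized_mean.
- exact: quantized_second_moment.
- exact: quantized_trunc_moment.
Qed.

End QuantizedMoments.

Lemma sum_prod_marginal (R : comNzRingType) (I : finType) n (p : 'I_n -> I -> R) i k0 :
  (forall i, \sum_k p i k = 1) ->
  \sum_(x : {ffun 'I_n -> I} | x i == k0) \prod_j p j (x j) = p i k0.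
Proof.
move=> p1; pose q j k := if (j == i) && (k != k0) then 0 else p j k.
transitivity (\prod_j \sum_k q j k).
  rewrite bigA_distr_bigA big_mkcond; apply: eq_bigr => x _ /=.
  have [xi|xi] := eqVneq (x i) k0.
    apply: eq_bigr => j _; rewrite /q; have [->|//] := eqVneq j i.
    by rewrite xi eqxx.
  by rewrite (bigD1 i) //= /q eqxx xi mul0r.
rewrite (bigD1 i) //= [X in _ * X]big1 ?mulr1 => [|j /negPf ji].
  rewrite (bigD1 k0) //= /q eqxx /= eqxx /= big1 ?addr0 // => k kk0.
  by rewrite kk0.
by rewrite /q ji /=.
Qed.

Lemma sqnormD_le (R : realType) m (x y : 'cV[R]_m) :
  sqnorm (x + y) <= 2 * sqnorm x + 2 * sqnorm y.
Proof.
rewrite /sqnorm !mulr_sumr -big_split ler_sum //= => j _; rewrite !mxE.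
by have := sqr_ge0 (x j 0 - y j 0); nra.
Qed.

Lemma sqnorm_comb_le (R : realType) n m (w : 'I_n -> 'cV[R]_m) (e : 'I_n -> R) h :
  (forall i, `|e i| <= h) ->
  sqnorm (\sum_i e i *: w i) <= h ^+ 2 * \sum_j (\sum_i `|w i j 0|) ^+ 2.
Proof.
move=> eh; rewrite /sqnorm mulr_sumr ler_sum // => j _.
rewrite -(real_normK (num_real _)) -exprMn summxE.
have le : `|\sum_i (e i *: w i) j 0| <= h * \sum_i `|w i j 0|.
  apply: le_trans (ler_norm_sum _ _ _) _; rewrite mulr_sumr ler_sum // => i _.
  by rewrite mxE normrM ler_wpM2r.
by rewrite lerXn2r ?nnegrE // (le_trans _ le).
Qed.

Lemma l2norm_le_sqnorm (R : realType) m (x : 'cV[R]_m) (r : R) :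
  l2norm x <= r -> sqnorm x <= r ^+ 2.
Proof.
move=> xr; rewrite -[leLHS](@sqr_sqrtr R) ?sqnorm_ge0 //.
by rewrite lerXn2r ?nnegrE ?sqrtr_ge0 // (le_trans _ xr) ?sqrtr_ge0.
Qed.

Section Event.
Context d (T : measurableType d) (R : realType) (P : probability T R).
Variables (n m : nat) (xi : 'I_n -> {RV P >-> R}) (w : 'I_n -> 'cV[R]_m).

Lemma measurable_small_ball z r :
  measurable [set t | l2norm (\sum_(i < n) xi i t *: w i - z) <= r].
Proof.
have mf : measurable_fun setT (fun t => l2norm (\sum_(i < n) xi i t *: w i - z)).
  suff ms : measurable_fun setT (fun t => sqnorm (\sum_(i < n) xi i t *: w i - z)).
    exact: (measurableT_comp (continuous_measurable_fun (@sqrt_continuous R)) ms).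
  apply: measurable_sum => j; apply: measurable_funX.
  have -> : (fun t => (\sum_(i < n) xi i t *: w i - z) j 0) =
     (fun t => (\sum_(i < n) xi i t * w i j 0) - z j 0).
    apply/funext => t; rewrite mxE [(- z) j 0]mxE summxE; congr (_ - _).
    by apply: eq_bigr => i _; rewrite mxE.
  apply: measurable_funB => //; apply: measurable_sum => i.
  by apply: measurable_funM => //.
have -> : [set t | l2norm (\sum_(i < n) xi i t *: w i - z) <= r] =
   (fun t => l2norm (\sum_(i < n) xi i t *: w i - z)) @^-1` `]-oo, r].
  by apply/seteqP; split => t /=; rewrite in_itv.
by rewrite -[Y in measurable Y]setTI; apply: mf => //; exact: measurable_itv.
Qed.

(** E is covered by the atoms of the joint law of the g (xi_i) that lie in Q, and
    each atom has the product probability by independence. *)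
Lemma quantized_union_bound (I : finType) (g : R -> I) (Q : pred {ffun 'I_n -> I})
    (E : set T) :
  mutually_independent xi -> (forall k, measurable (g @^-1` [set k])) -> measurable E ->
  (forall t, E t -> Q [ffun i => g (xi i t)]) ->
  (P E <= (\sum_(x | Q x) \prod_i fine (P (xi i @^-1` (g @^-1` [set x i]))))%:E)%E.
Proof.
move=> ind mg mE EQ.
pose B (x : {ffun 'I_n -> I}) : set T :=
  \bigcap_(i in [set` [set: 'I_n]%SET]) (xi i @^-1` (g @^-1` [set x i])).
have PB x : P (B x) = (\prod_i fine (P (xi i @^-1` (g @^-1` [set x i]))))%:E.
  rewrite /B (ind _ (fun i => g @^-1` [set x i])) // -prodEFin.
  rewrite (eq_bigl xpredT) => [|i]; last by rewrite inE.
  by apply: eq_bigr => i _; rewrite fineK // fin_num_measure //; exact: measurable_funPTI.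
have mB x : measurable (B x).
  apply: fin_bigcap_measurable => [|i _]; last exact: measurable_funPTI.
  exact: finite_finset.
have := @content_sub_fsum _ _ _ P _ [set` enum Q] E B (finite_seq _) (fun x _ => mB x) mE.
move/(_ _)/le_trans; apply.
  move=> t Et; exists [ffun i => g (xi i t)]; last by move=> i _ /=; rewrite ffunE.
  by rewrite /= mem_enum; exact: EQ.
rewrite -fsbig_seq ?enum_uniq // big_enum /= -sumEFin.
by rewrite le_eqVlt; apply/orP; left; apply/eqP; apply: eq_bigr => x _; exact: PB.
Qed.
End Event.

(** * The small-ball estimate *)

(** Discretisation.  If no variable overflows the rounding range, the sum of the
    rounded variables is at distance at most eta sqrt m from the original one, so
    that it lies in the ball of radius 2 eta sqrt m; the overflow probability is
    at most n / (N h)^2 by Chebyshev's inequality, hence at most eps. *)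
Lemma small_ball_approx d (T : measurableType d) (R : realType) (P : probability T R)
    (n m : nat) (xi : 'I_n -> {RV P >-> R}) (w : 'I_n -> 'cV[R]_m) (M rho eta eps : R)
    (z : 'cV[R]_m) :
  0 < M -> (0 < m)%N -> mutually_independent xi ->
  (forall i, 'E_P[xi i] = 0)%E -> (forall i, 'V_P[xi i] = 1)%E ->
  (forall i, ((2^-1)%:E <=
     'E_P[fun t => (xi i t ^+ 2 * \1_[set s | `|xi i s| <= M] t)%R])%E) ->
  loewner_ge (\sum_(i < n) w i *m (w i)^T) 1%:M ->
  0 < rho -> (forall i, sqnorm (w i) <= rho ^+ 2) ->
  0 < eta -> 2 * rho <= eta * (M + 13)^-1 -> 0 < eps ->
  (P [set t | (l2norm (\sum_(i < n) xi i t *: w i - z) <= eta * Num.sqrt m%:R)%R] <=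
   ((expR (5 / 2) * 32 * Num.sqrt 128 * eta) ^+ m + eps)%:E)%E.
Proof.
move=> M0 m0 ind EX VX TX wI rho0 wrho eta0 large eps0.
have m1 : 1 <= m%:R :> R by rewrite ler1n.
pose S := \sum_j (\sum_i `|w i j 0|) ^+ 2.
have S0 : 0 <= S by apply: sumr_ge0 => j _; exact: sqr_ge0.
have [h h0 hP] : exists2 h, 0 < h & [/\ h <= 32^-1, h * M <= 32^-1 & h ^+ 2 * S <= eta ^+ 2].
  (* Each summand of D serves one of the three conditions. *)
  pose D := 32 + 32 * M + (1 + S) / eta.
  have De : 0 <= (1 + S) / eta by rewrite divr_ge0 ?(ltW eta0) //; lra.
  have D0 : 0 < D by rewrite /D; lra.
  exists D^-1; first by rewrite invr_gt0.
  split.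
  - by rewrite lef_pV2 ?posrE // /D; lra.
  - by rewrite mulrC ler_pdivrMr // /D; nra.
  - have DS : 1 + S <= D * eta.
      by rewrite -ler_pdivrMr // /D; lra.
    rewrite exprVn mulrC ler_pdivrMr ?exprn_gt0 // -exprMn [eta * D]mulrC.
    apply: (@le_trans _ _ ((1 + S) ^+ 2)); first by nra.
    by rewrite ler_pXn2r ?nnegrE //; nra.
case: hP => h32 hM hS.
pose N := (Num.truncn ((M + 32 + n%:R / eps) / h)).+1.
have NA : M + 32 + n%:R / eps <= N%:R * h.
  by rewrite -ler_pdivrMr // ltW // truncnS_gt.
have ne : 0 <= n%:R / eps by rewrite divr_ge0 // ltW.
have A32 : M + 32 <= N%:R * h by lra.
pose g := quantize h N; pose p i := quantized_prob (xi i) h (N := N).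
pose v := cell_value h (N := N).
pose good (x : {ffun 'I_n -> option 'I_N.*2}) :=
  sqnorm (\sum_i v (x i) *: w i - z) <= 4 * eta ^+ 2 * m%:R.
pose bad (x : {ffun 'I_n -> option 'I_N.*2}) := [exists i, x i == None].
have p0 i k : 0 <= p i k := quantized_prob_ge0 _ _ _.
have p1 i : \sum_k p i k = 1 by exact: (quantized_prob_sum1 N (EX i) (VX i) (TX i) h0).
have pp (x : {ffun 'I_n -> option 'I_N.*2}) : 0 <= \prod_i p i (x i) by rewrite prodr_ge0.
apply: le_trans (quantized_union_bound (g := g) (Q := fun x => good x || bad x) ind _ _ _) _.
- exact: measurable_quantize.
- exact: measurable_small_ball.
- move=> t /= tE; have [//|nb] := boolP (bad _); first by rewrite orbT.
  rewrite orbF /good.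
  set x := [ffun i => _] in nb *.
  have e_le i : `|v (x i) - xi i t| <= h.
    case qx : (quantize h N (xi i t)) => [l|]; last first.
      by case/negP: nb; apply/existsP; exists i; rewrite ffunE /g qx.
    have /andP[e0 eh] := cell_valueP qx.
    by rewrite distrC /v /x ffunE /g qx ger0_norm.
  have -> : \sum_i v (x i) *: w i - z =
      (\sum_i xi i t *: w i - z) + \sum_i (v (x i) - xi i t) *: w i.
    rewrite addrAC -big_split /=; congr (_ - _); apply: eq_bigr => i _.
    by rewrite -scalerDl addrC subrK.
  apply: le_trans (sqnormD_le _ _) _.
  have a1 : sqnorm (\sum_i xi i t *: w i - z) <= eta ^+ 2 * m%:R.
    by have := l2norm_le_sqnorm tE; rewrite exprMn sqr_sqrtr.
  have a2 := sqnorm_comb_le w e_le; rewrite -/S in a2.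
  have e2 : 0 <= eta ^+ 2 := sqr_ge0 _; nra.
rewrite lee_fin.
apply: (@le_trans _ _ (\sum_(x | good x) \prod_i p i (x i) +
   \sum_i \sum_(x : {ffun 'I_n -> option 'I_N.*2} | x i == None) \prod_i p i (x i))).
  rewrite (bigID good) /=; apply: lerD.
    rewrite big_mkcond [leRHS]big_mkcond ler_sum // => x _ /=.
    by case: (good x); rewrite /= ?orbT ?andbF.
  rewrite (exchange_big_dep xpredT) //= big_mkcond ler_sum //= => x _.
  case: ifP => [/andP[/orP[->//|/existsP[i xi0]] _]|_]; last first.
    by apply: sumr_ge0.
  by rewrite [leRHS](bigD1 i) //= lerDl sumr_ge0.
apply: lerD.
  have dlt0 : 0 < (M + 13)^-1 by rewrite invr_gt0; lra.
  have gap i u : `|u| <= (M + 13)^-1 -> u ^+ 2 / 16 <= 1 - charfun_sq (p i) (v : _ -> R) u.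
    exact: (quantized_gap (EX i) (VX i) (TX i)).
  exact: (small_ball_discrete (v := fun=> v) p0 p1 dlt0 gap wI rho0 wrho eta0 large z).
apply: (@le_trans _ _ (\sum_(i < n) ((N%:R * h) ^+ 2)^-1)).
  apply: ler_sum => i _; rewrite (sum_prod_marginal _ _ p1).
  exact: (quantized_prob_none (EX i) (VX i) (TX i)).
rewrite sumr_const card_ord -[leLHS]mulr_natl ler_pdivrMr; last by rewrite exprn_gt0 //; lra.
have : n%:R <= eps * (N%:R * h) by rewrite -ler_pdivrMl // mulrC; lra.
move/le_trans; apply; rewrite ler_wpM2l ?(ltW eps0) //.
by have : 1 <= N%:R * h by [lra]; nra.
Qed.

Theorem proposition2p4 (R : realType) (M : R) (hM : 0 < M) :
  exists2 C : R, 0 < C &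
  forall (n m : nat) (d : measure_display) (T : measurableType d)
    (P : probability T R) (xi : 'I_n -> {RV P >-> R})
    (w : 'I_n -> 'cV[R]_m) (rho : R),
    mutually_independent xi ->
    (forall i, 'E_P[xi i] = 0)%E ->
    (forall i, 'V_P[xi i] = 1)%E ->
    ((2^-1)%:E <= ereal_inf (range (fun i : 'I_n =>
       'E_P[fun t => (xi i t ^+ 2 * \1_[set s | `|xi i s| <= M] t)%R])))%E ->
    loewner_ge (\sum_(i < n) w i *m (w i)^T) 1%:M ->
    0 < rho ->
    \big[Order.max/0]_(i < n) l2norm (w i) <= rho ->
    forall eta : R, C * rho <= eta ->
      (ereal_sup (range (fun z : 'cV[R]_m =>
         P [set t | (l2norm (\sum_(i < n) xi i t *: w i - z) <=
                     eta * Num.sqrt m%:R)%R]))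
       <= ((C * eta) ^+ m)%:E)%E.
Proof.
pose C0 : R := expR (5 / 2) * 32 * Num.sqrt 128.
have C00 : 0 < C0 by rewrite !mulr_gt0 ?expR_gt0 ?sqrtr_gt0.
exists (C0 + 2 * (M + 13)); first by lra.
move=> n m d T P xi w rho ind EX VX TX wI rho0 wmax eta large.
have eta0 : 0 < eta by apply: lt_le_trans large; rewrite mulr_gt0 //; lra.
apply: ge_ereal_sup => _ [z _ <-].
(* For m = 0 the discretisation fails, as the ball then has radius 0. *)
case: m => [|m] in w wI wmax z *.
  by rewrite expr0; apply: probability_le1; exact: measurable_small_ball.
apply/lee_addgt0Pr => eps eps0.
apply: (le_trans (small_ball_approx (M := M) (rho := rho) z hM _
  ind EX VX _ wI rho0 _ eta0 _ eps0)) => //.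
- by move=> i; apply: le_trans TX _; apply: ereal_inf_lbound; exists i.
- move=> i; apply: l2norm_le_sqnorm; apply: le_trans wmax.
  exact: (le_bigmax _ (fun i => l2norm (w i))).
- rewrite ler_pdivlMr; last by lra.
  apply: le_trans large; rewrite mulrAC mulrDl; nra.
have Ceta : C0 * eta <= (C0 + 2 * (M + 13)) * eta by rewrite ler_wpM2r ?(ltW eta0) //; lra.
have Ceta0 : 0 <= C0 * eta by rewrite mulr_ge0 ?ltW.
rewrite -EFinD lee_fin lerD2r -/C0.
by apply: lerXn2r => //; rewrite nnegrE // (le_trans Ceta0).
Qed.
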